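(* Let $n\ge 4$ and let $\lambda$ be a partition of $n$. Let $r_1$ and $r_2$ be the numbers of hooks of length $1$ and of length $2$ in $\lambda$, respectively, and set $a_1=r_1-1$ and $a_2=r_2+r_1(r_1-2)$. Then $$sg(\lambda,(n-1,1))=a_1,\quad ag(\lambda,(n-1,1))=0,\quad sg(\lambda,(n-2,2))=a_2,\quad ag(\lambda,(n-2,2))=0,$$ $$sg(\lambda,(n-2,1^2))=\binom{r_1-1}{2},\quad ag(\lambda,(n-2,1^2))=\binom{r_1}{2}.$$ That is, $$S^2([\lambda])=[n]+a_1[n-1,1]+a_2[n-2,2]+\binom{r_1-1}{2}[n-2,1^2]+\text{constituents of depth}>2,$$ $$A^2([\lambda])=\binom{r_1}{2}[n-2,1^2]+\text{constituents of depth}>2.$$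
   Context: For a partition $\lambda$ of $n$, $[\lambda]$ denotes the irreducible complex character of the symmetric group $S_n$ labelled by $\lambda$. For a character $\chi$ of a finite group, $S^2(\chi)(g)=\tfrac12(\chi(g)^2+\chi(g^2))$ and $A^2(\chi)(g)=\tfrac12(\chi(g)^2-\chi(g^2))$. The coefficients $sg(\lambda,\mu)$, $ag(\lambda,\mu)$ are defined by $S^2([\lambda])=\sum_\mu sg(\lambda,\mu)[\mu]$ and $A^2([\lambda])=\sum_\mu ag(\lambda,\mu)[\mu]$. The hook at a box $(i,j)$ of the Young diagram of $\lambda$ consists of $(i,j)$, the boxes to its right in row $i$ and the boxes below it in column $j$; its length is its number of boxes (so $r_1$ is the number of removable boxes). The depth of a partition $\mu$ of $n$ (and of $[\mu]$) is $n-\mu_1$. *)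

(* Defs.v *)
From HB Require Import structures.
From mathcomp Require Import all_boot all_order all_fingroup all_algebra.
From mathcomp Require Import all_solvable all_field all_character.

Set Implicit Arguments.
Unset Strict Implicit.
Unset Printing Implicit Defensive.

Import Order.TTheory GroupScope GRing.Theory Num.Theory.
Local Open Scope ring_scope.

Definition is_partition (n : nat) (la : seq nat) : bool :=
  [&& sorted geq la, 0%N \notin la & sumn la == n].

Definition partitions (n : nat) : seq (seq nat) :=
  [seq la <- [seq map val (bseqval mu) | mu : n.-bseq 'I_n.+1]
     | is_partition n la].

Lemma mem_partitions n la : (la \in partitions n) = is_partition n la.
Proof.
rewrite mem_filter andb_idr // => la_part.
have /and3P[_ la_n0 /eqP la_sum] := la_part.
have le_n : all (fun k => k < n.+1)%N la.
  apply/allP => k k_la; rewrite ltnS -la_sum.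
  by rewrite (perm_sumn (perm_to_rem k_la)) /= leq_addr.
have sz_n : (size la <= n)%N.
  rewrite -la_sum; elim: la la_n0 {la_part la_sum le_n} => //= k s IHs.
  rewrite inE negb_or eq_sym -lt0n => /andP[k_gt0 /IHs].
  by rewrite -add1n; apply: leq_add.
have inordK_la : map val (map (@inord n) la) = la.
  rewrite -map_comp -[RHS]map_id; apply/eq_in_map => k /(allP le_n) k_le /=.
  exact: inordK.
have sz_n' : (size (map (@inord n) la) <= n)%N by rewrite size_map.
by apply/imageP; exists (Bseq sz_n').
Qed.

Lemma partitions_uniq n : uniq (partitions n).
Proof.
rewrite filter_uniq // map_inj_uniq ?enum_uniq // => mu nu.
by move/(inj_map val_inj)/val_inj.
Qed.

Definition conj_partition (la : seq nat) : seq nat :=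
  [seq count (fun p => j < p)%N la | j <- iota 0 (head 0%N la)].

Definition depth (mu : seq nat) : nat := (sumn mu - head 0%N mu)%N.

(* Boxes are (row, column), both counted from 0. *)
Definition boxes (la : seq nat) : seq (nat * nat) :=
  [seq (i, j) | i <- iota 0 (size la), j <- iota 0 (nth 0%N la i)].

Definition hook (la : seq nat) (b : nat * nat) : seq (nat * nat) :=
  [seq c <- boxes la | ((c.1 == b.1) && (b.2 <= c.2)%N)
                    || ((c.2 == b.2) && (b.1 <= c.1)%N)].

Definition nhooks (k : nat) (la : seq nat) : nat :=
  count (fun b => size (hook la b) == k) (boxes la).

(* [reshape_index la i] is the row of i when 0, 1, ..., n - 1 are written
   row by row into the diagram of la. *)
Definition young_set (n : nat) (la : seq nat) : {set 'S_n} :=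
  [set s : 'S_n | [forall i, reshape_index la (s i) == reshape_index la i]].

Fact young_group_set n la : group_set (young_set n la).
Proof.
apply/group_setP; split=> [|s t].
  by rewrite inE; apply/forallP => i; rewrite perm1.
rewrite !inE => /forallP s_la /forallP t_la; apply/forallP => i.
by rewrite permM (eqP (t_la _)).
Qed.

Canonical young_group n la := Group (young_group_set n la).

Fact sign_char_subproof n :
  is_class_fun <<[set: 'S_n]>> [ffun s : 'S_n => (-1) ^+ odd_perm s].
Proof.
apply: intro_class_fun => [s t _ _ | s]; first by rewrite odd_permJ.
by case/negP; apply: mem_gen; rewrite inE.
Qed.

Definition sign_char n : 'CF([set: 'S_n]) := Cfun 0 (sign_char_subproof n).

(* James and Kerber's labelling: [la] is the unique common irreducible
   constituent of the trivial character of the Young subgroup of la and of the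
   sign character of the Young subgroup of la', both induced to 'S_n; thus
   [n] is the trivial character and [1^n] the sign character. *)
Definition Sn_Iirr (n : nat) (la : seq nat) : Iirr [set: 'S_n] :=
  odflt 0 [pick i : Iirr [set: 'S_n] |
    (i \in irr_constt ('Ind[[set: 'S_n], young_group n la] 1))
    && (i \in irr_constt ('Ind[[set: 'S_n]]
               ('Res[young_group n (conj_partition la)] (sign_char n))))].

Definition Sn_irr (n : nat) (la : seq nat) : 'CF([set: 'S_n]) :=
  'chi_(Sn_Iirr n la).

(* The factor [g \in G] is needed since a class function on G vanishes outside
   G, whereas g ^+ 2 may lie in G when g does not. *)
Fact cfSym2_subproof (gT : finGroupType) (G : {group gT}) (chi : 'CF(G)) :
  is_class_fun <<G>>
    [ffun g => (g \in G)%:R * (2^-1 * (chi g ^+ 2 + chi (g ^+ 2)%g))].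
Proof.
rewrite genGid; apply: intro_class_fun => [x y Gx Gy | x /negPf->].
  by rewrite groupJ // Gx -conjXg !cfunJ.
by rewrite mul0r.
Qed.

Fact cfAlt2_subproof (gT : finGroupType) (G : {group gT}) (chi : 'CF(G)) :
  is_class_fun <<G>>
    [ffun g => (g \in G)%:R * (2^-1 * (chi g ^+ 2 - chi (g ^+ 2)%g))].
Proof.
rewrite genGid; apply: intro_class_fun => [x y Gx Gy | x /negPf->].
  by rewrite groupJ // Gx -conjXg !cfunJ.
by rewrite mul0r.
Qed.

Definition cfSym2 (gT : finGroupType) (G : {group gT}) (chi : 'CF(G)) : 'CF(G) :=
  Cfun 0 (cfSym2_subproof chi).

Definition cfAlt2 (gT : finGroupType) (G : {group gT}) (chi : 'CF(G)) : 'CF(G) :=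
  Cfun 0 (cfAlt2_subproof chi).

(* The irreducible characters form an orthonormal family, so these inner
   products are the coefficients in the expansions of the two squares. *)
Definition sg (n : nat) (la mu : seq nat) : algC :=
  '[cfSym2 (Sn_irr n la), Sn_irr n mu].

Definition ag (n : nat) (la mu : seq nat) : algC :=
  '[cfAlt2 (Sn_irr n la), Sn_irr n mu].

(* Main.v *)
Require Import Defs.
From mathcomp Require Import all_boot all_order all_fingroup all_algebra.
From mathcomp Require Import all_solvable all_field all_character.
From mathcomp Require Import zify ring.

Set Implicit Arguments.
Unset Strict Implicit.
Unset Printing Implicit Defensive.

Import Order.TTheory GroupScope GRing.Theory Num.Theory.
Local Open Scope ring_scope.

(** Write chi for the irreducible character [la], and let r1, r2 be its numbers
of hooks of length 1 and 2.

A character of depth at most 2 is a signed sum of at most four Young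
permutation characters, by the determinantal formula with three rows
([jacobi_trudi3]).  By Frobenius reciprocity the multiplicity of a class
function phi in such a permutation character is the average of phi over
S_n, S_(n-1), S_(n-2) or S_(n-2) x S_2.  When phi is the symmetric or the
alternating square of chi, this average is half the sum or half the difference
of the averages of chi(g)^2 and of chi(g^2).  The first is the norm of the
restriction of chi.  The second counts the irreducible constituents of the
restriction, because all irreducible characters of symmetric groups have
Frobenius-Schur indicator 1 ([det_char_indicator]); on S_(n-2) x S_2 it is the
same as on S_(n-2), because (a t)^2 = a^2 for the transposition t.  Both are
then read off from the branching rule: the restriction to S_(n-1) has r1
constituents, all distinct; the restriction to S_(n-2) has r2 + r1 (r1 - 1)
constituents, those that come from two disconnected boxes occurring twice; and
chi(a t) is a sum of r2 distinct irreducible characters of S_(n-2), up to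
signs.

The branching rule is obtained from a determinantal model of the characters.
The group S_n acts on words of length n over l letters; the content of a word
counts its letters, and the words of given content form an orbit.  For a
vector b of l beta-numbers, [det_char b] is the alternating sum over s in S_l
of the permutation characters of content b - s(l - 1, ..., 1, 0).  Its value at
g is a signed count of the words fixed by g.  A fixed point of g carries one
letter i of such a word, and a 2-cycle carries one letter twice; deleting them
lowers the entry b_i by 1 or by 2, whence the rules [det_char_up] and
[det_char_up_last2].  A term survives exactly if the lowered vector has no
repeated entry, and such moves are the hooks of length 1 and 2
([nhooks_movable]).

Two facts make this model work.

- The characters [det_char b] for decreasing b are orthonormal
  ([cfdot_det_char]).  By Burnside's lemma the inner product is a signed count
  of l x l matrices with prescribed margins.  Counting the units of each entry
  gives a recursion in n for this number, and the expected value, the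
  determinant of the matrix with entries 1 if b_i = c_j and 0 otherwise,
  satisfies the same recursion ([match_det_energy]).

- They are the irreducible characters with their usual labels
  ([det_char_irr]).  Counting words with signs, the permutation character of
  content la and the sign twist of that of the conjugate content have inner
  product 1, so they share exactly one irreducible constituent.  All other
  terms of the determinant have larger content in the dominance order and are
  orthogonal to the twisted character, so the common constituent has inner
  product 1 with the determinantal character, and equals it, both having
  norm 1.

That every irreducible character has a label ([Sn_Iirr_surj]) follows by
inverting the unitriangular determinantal formula: the permutation characters,
among them the regular character, are combinations of determinantal ones.
Indicator 1 follows from reality and multiplicity one in a permutation
character, through the spherical function of the invariant line
([frobenius_schur_mult1]). *)

(** * Words, contents and stabilisers *)

Section Words.

Variables (n : nat) (C : finType).
Implicit Types (w u : {ffun 'I_n -> C}) (g h : 'S_n).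

Definition content w : {ffun C -> nat} :=
  [ffun c => #|[pred x | w x == c]|].

Definition wact w g : {ffun 'I_n -> C} := [ffun x => w (g x)].

Lemma wact1 w : wact w 1%g = w.
Proof. by apply/ffunP => x; rewrite ffunE perm1. Qed.

Lemma wactM w g h : wact w (g * h)%g = wact (wact w h) g.
Proof. by apply/ffunP => x; rewrite !ffunE permM. Qed.

Lemma wact_inj g : injective (wact^~ g).
Proof.
by apply: (can_inj (g := wact^~ g^-1%g)) => w; rewrite -wactM mulVg wact1.
Qed.

Lemma content_wact w g : content (wact w g) = content w.
Proof.
apply/ffunP => c; rewrite !ffunE -(card_image (@perm_inj _ g)).
apply: eq_card => x; rewrite -[x](permKV g) (mem_map (@perm_inj _ g)) inE.
by rewrite mem_enum inE ffunE permKV.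
Qed.

Lemma content_codom w c : content w c = count_mem c (codom w).
Proof.
rewrite ffunE cardE /enum_mem size_filter codomE count_map -enumT.
by apply: eq_count => x; rewrite !inE.
Qed.

(** The orbits of the symmetric group on words are the fibres of the content:
  words with equal contents are permutations of each other as tuples. *)
Lemma eq_content_wact w u : content w = content u -> exists g, u = wact w g.
Proof.
move=> eq_wu.
have /tuple_permP[g def_u] : perm_eq [tuple u i | i < n] [tuple w i | i < n].
  by apply/allP => c _ /=; rewrite -!codomE -!content_codom eq_wu.
exists g; apply/ffunP => x; rewrite ffunE.
have /val_inj/(congr1 (fun s => tnth s x)) := def_u.
by rewrite !tnth_mktuple.
Qed.

Lemma sum_content w : (\sum_c content w c = n)%N.
Proof.
rewrite -[RHS](card_ord n) -sum1_card (partition_big w predT) //=.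
by apply: eq_bigr => c _; rewrite ffunE -sum1_card; apply: eq_bigl => x.
Qed.

Lemma exists_content (a : {ffun C -> nat}) :
  (\sum_c a c = n)%N -> exists w, content w = a.
Proof.
move=> sum_a.
pose s := flatten [seq nseq (a c) c | c <- enum C].
have sz_s : size s == n.
  rewrite size_flatten /shape -map_comp sumnE big_map -sum_a big_enum /=.
  by apply/eqP/eq_bigr => c _; rewrite size_nseq.
exists [ffun x => tnth (Tuple sz_s) x]; apply/ffunP => c.
rewrite content_codom.
have -> : codom [ffun x => tnth (Tuple sz_s) x] = s.
  rewrite codomE (eq_map (g := tnth (Tuple sz_s))) ?map_tnth_enum // => x.
  by rewrite ffunE.
rewrite /s count_flatten -map_comp sumnE big_map big_enum /= (bigD1 c) //=.
rewrite count_nseq /= eqxx mul1n big1 ?addn0 // => d /negPf ne_dc.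
by rewrite count_nseq /= ne_dc.
Qed.

Definition stab_set w : {set 'S_n} := [set g | wact w g == w].

Fact stab_group_set w : group_set (stab_set w).
Proof.
apply/group_setP; split=> [|g h]; first by rewrite inE wact1.
by rewrite !inE wactM => /eqP wg /eqP->; apply/eqP.
Qed.

Canonical stab w := Group (stab_group_set w).

Lemma card_transporter w h : #|[set g | wact w g == wact w h]| = #|stab w|.
Proof.
rewrite -(card_imset [set g | wact w g == wact w h] (mulgI h^-1%g)).
apply: eq_card => g; apply/imsetP/idP => [[k]|].
  by rewrite !inE => /eqP wk ->; rewrite wactM wk -wactM mulVg wact1.
rewrite inE => /eqP wg; exists (h * g)%g; last by rewrite mulKg.
by rewrite inE wactM wg.
Qed.

Lemma card_stab_wact w h : #|stab (wact w h)| = #|stab w|.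
Proof.
rewrite -(card_transporter w h) -(card_imset (stab (wact w h)) (mulIg h)).
apply: eq_card => g; apply/imsetP/idP => [[k]|].
  by rewrite !inE => /eqP wk ->; rewrite wactM wk.
rewrite inE => /eqP wg; exists (g * h^-1)%g; last by rewrite mulgKV.
by rewrite inE -wactM mulgKV wg.
Qed.

(** Count the group by the value of [wact w0] at its elements: those that send
  w0 to w form a coset of the stabiliser of w. *)
Lemma sum_stab_content (a : {ffun C -> nat}) :
  (\sum_c a c = n)%N -> (\sum_(w | content w == a) #|stab w| = n`!)%N.
Proof.
move=> /exists_content[w0 def_a].
rewrite -card_Sn -[RHS]cardsT -sum1_card.
rewrite (partition_big (wact w0) (fun w => content w == a)) /= => [|g _];
  last first.
  by rewrite content_wact def_a.
apply: eq_bigr => w /eqP; rewrite -def_a => /esym/eq_content_wact[h ->].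
rewrite card_stab_wact -(card_transporter w0 h) -sum1_card.
by apply: eq_bigl => g; rewrite !inE.
Qed.

Lemma content_le w c : (content w c <= n)%N.
Proof. by rewrite -[leqRHS](sum_content w) (bigD1 c) //= leq_addr. Qed.

(** Burnside's lemma with weights: every orbit contributes n! times its weight,
  and orbits are vectors of multiplicities. The bound N keeps the index type
  fixed when n varies. *)
Lemma burnside N (f : {ffun C -> nat} -> algC) : (n <= N)%N ->
  \sum_(g : 'S_n) \sum_(w | wact w g == w) f (content w)
  = n`!%:R * \sum_(A : {ffun C -> 'I_N.+1} | (\sum_c A c)%N == n)
                f [ffun c => A c : nat].
Proof.
move=> le_nN; rewrite (exchange_big_dep predT) //= mulr_sumr.
rewrite (partition_big (fun w => [ffun c => inord (content w c) : 'I_N.+1])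
  (fun A => (\sum_c A c)%N == n)) /= => [|w _]; last first.
  apply/eqP; rewrite -[RHS](sum_content w); apply: eq_bigr => c _.
  by rewrite ffunE inordK // ltnS (leq_trans (content_le w c)).
apply: eq_bigr => A /eqP sumA; pose a := [ffun c => A c : nat].
have sum_a : (\sum_c a c = n)%N.
  by rewrite -sumA; apply: eq_bigr => c _; rewrite ffunE.
rewrite -(sum_stab_content sum_a) natr_sum mulr_suml.
have eqA w : ([ffun c => inord (content w c)] == A) = (content w == a).
  apply/eqP/eqP => [defA|->]; apply/ffunP => c; last first.
    by rewrite !ffunE inord_val.
  by rewrite [RHS]ffunE -defA ffunE inordK // ltnS (leq_trans (content_le w c)).
rewrite (eq_bigl _ _ eqA); apply: eq_bigr => w /eqP->.
rewrite sumr_const mulr_natl; congr (_ *+ _).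
by apply: eq_card => g; rewrite !inE.
Qed.

End Words.

(** * Injections into the natural numbers *)

Section DistinctValues.

Variables (T : finType) (R : {set T}) (b : T -> nat).
Hypothesis b_inj : {in R &, injective b}.

Let rank i := #|[set j in R | (b j < b i)%N]|.

Lemma rank_le i : (rank i <= b i)%N.
Proof.
rewrite /rank cardE -(size_map b) -[leqRHS](size_iota 0).
apply: uniq_leq_size => [|x /mapP[j]].
  rewrite map_inj_in_uniq ?enum_uniq // => j k; rewrite !mem_enum !inE.
  by move=> /andP[Rj _] /andP[Rk _]; apply: b_inj.
by rewrite mem_enum inE => /andP[_ ltb] ->; rewrite mem_iota.
Qed.

Lemma sum_rank : (\sum_(i in R) rank i = 'C(#|R|, 2))%N.
Proof.
have rankE i : (rank i = \sum_(j in R) (b j < b i))%N.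
  by rewrite /rank -sum1dep_card big_mkcondr.
apply/eqP;
  rewrite -(eqn_pmul2l (isT : 0 < 2)%N) -mul_bin_diag bin1 mul2n -addnn.
rewrite (eq_bigr _ (fun i _ => rankE i)) {2}exchange_big -big_split /=.
apply/eqP; rewrite -sum_nat_const; apply: eq_bigr => i Ri.
rewrite -big_split (bigD1 i) //= ltnn add0n.
rewrite (eq_bigr (fun=> 1%N)) => [|j /andP[Rj ne_ji]]; last first.
  case: ltngtP => // /b_inj eq_ji; by rewrite eq_ji ?eqxx // in ne_ji.
by rewrite (cardsD1 i) Ri -sum1_card; apply: eq_bigl => j; rewrite !inE andbC.
Qed.

(** The number of values below [b i] is at most [b i], and these ranks take the
  values 0, 1, 2 and so on. *)
Lemma sum_distinct_ge : ('C(#|R|, 2) <= \sum_(i in R) b i)%N.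
Proof. by rewrite -sum_rank; apply: leq_sum => i _; apply: rank_le. Qed.

(** In the equality case every value equals its rank. *)
Lemma sum_distinct_min :
  (\sum_(i in R) b i <= 'C(#|R|, 2))%N -> {in R, forall i, (b i < #|R|)%N}.
Proof.
rewrite -sum_rank => le_sum.
have: (\sum_(i in R) (b i - rank i) == 0)%N.
  rewrite sumnB => [|i _]; last exact: rank_le.
  by rewrite subn_eq0.
rewrite sum_nat_eq0 => /forall_inP eq0 i Ri.
have := eq0 i Ri; rewrite subn_eq0 => /leq_ltn_trans-> //.
by rewrite /rank proper_card //; apply/properP; split;
  [apply/subsetP => j; rewrite inE => /andP[] | exists i;
    rewrite // inE ltnn andbF].
Qed.

End DistinctValues.

Lemma prod_natb (I : finType) (P : pred I) :
  \prod_i (P i)%:R = [forall i, P i]%:R :> algC.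
Proof.
case: (boolP [forall i, P i]) => [/forallP allP | ].
  by rewrite big1 // => i _; rewrite allP.
by rewrite negb_forall => /existsP[i /negPf notPi];
  rewrite (bigD1 i) //= notPi mul0r.
Qed.

Lemma sum_ltn (K m : nat) : (m <= K)%N -> (\sum_(k < K) (k < m) = m)%N.
Proof.
move=> /subnKC <-; rewrite big_split_ord /= (eq_bigr (fun=> 1%N)) => [|k _].
  rewrite sum_nat_const card_ord muln1 big1 ?addn0 // => k _.
  by rewrite ltnNge leq_addr.
by rewrite ltn_ord.
Qed.

(** * The determinant matching two vectors *)

Section MatchDet.

Variable l : nat.
Implicit Types (b c : {ffun 'I_l -> nat}) (i j : 'I_l) (k : nat) (p : 'S_l).

(** The inner product of the wedge products of the basis vectors with indices b
  and c. *)
Definition match_det b c : algC := \det (\matrix_(i, j) (b i == c j)%:R).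

Lemma match_detE b c :
  match_det b c = \sum_(p : 'S_l) (-1) ^+ p * [forall i, b i == c (p i)]%:R.
Proof.
apply: eq_bigr => p _; rewrite -prod_natb; congr (_ * _).
by apply: eq_bigr => i _; rewrite mxE.
Qed.

Lemma match_det_ninj b c : ~ injective b -> match_det b c = 0.
Proof.
move/injectiveP/injectivePn => [i [j ne_ij eq_b]].
by apply: (determinant_alternate ne_ij) => m; rewrite !mxE eq_b.
Qed.

Lemma match_det_same b : injective b -> match_det b b = 1.
Proof.
move=> b_inj; rewrite /match_det -[RHS](det1 _ l); congr (\det _).
by apply/matrixP => i j; rewrite !mxE (inj_eq b_inj).
Qed.

Lemma match_det_sym b c : match_det b c = match_det c b.
Proof.
rewrite /match_det -det_tr; congr (\det _).
by apply/matrixP => i j; rewrite !mxE eq_sym.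
Qed.

Lemma match_det_perm b c p : injective b -> (forall i, b i = c (p i)) ->
  match_det b c = (-1) ^+ p.
Proof.
move=> b_inj eq_bc; rewrite -(det_perm _ p); congr (\det _).
apply/matrixP => i j; rewrite !mxE -{1}(permKV p j) -eq_bc (inj_eq b_inj).
by rewrite (canF_eq (permK p)).
Qed.

Definition lower b i k : {ffun 'I_l -> nat} :=
  [ffun m => if m == i then (b m - k)%N else b m].

Lemma sum_lower b i k : (k <= b i)%N ->
  (\sum_m lower b i k m + k = \sum_m b m)%N.
Proof.
move=> le_kb; rewrite (bigD1 i) //= [in RHS](bigD1 i) //= ffunE eqxx.
rewrite addnAC subnK //; congr (_ + _)%N.
by apply: eq_bigr => m /negPf ne_mi; rewrite ffunE ne_mi.
Qed.

Section Energy.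

Variables (b c : {ffun 'I_l -> nat}) (K : nat).
Hypothesis le_bK : forall i, (b i <= K)%N.

Let lowered i j k p :=
  [&& (k < b i)%N, (k < c j)%N &
   [forall m, lower b i k.+1 m == lower c j k.+1 (p m)]].
Let matched p := [forall m, b m == c (p m)].
Let crossed i j p :=
  [forall m, (m != i) && (m != j) ==> (b m == c (p m))]
  && (b i + b j == c (p i) + c (p j))%N.

Let lowered_diag i p k : lowered i (p i) k p = matched p && (k < b i)%N.
Proof.
apply/and3P/andP => [[lt_b lt_c /forallP eqv]|[/forallP eqv lt_b]].
  split=> //; apply/forallP => m; have := eqv m;
    rewrite !ffunE (inj_eq perm_inj).
  by have [->|_ //] := eqVneq m i; rewrite -(eqn_add2r k.+1) !subnK.
split=> //; first by rewrite -(eqP (eqv i)).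
by apply/forallP => m; rewrite !ffunE (inj_eq perm_inj) (eqP (eqv m)).
Qed.

Let lowered_cross i j p k : i != j ->
  lowered i (p j) k p =
    [&& crossed i j p, (c (p i) < b i)%N & k == (b i - c (p i)).-1].
Proof.
move=> ne_ij; apply/and3P/and3P.
  move=> [lt_b lt_c /forallP eqv].
  have := eqv i; have := eqv j; rewrite !ffunE !(inj_eq perm_inj) !eqxx.
  rewrite (eq_sym j) (negPf ne_ij) => /eqP eq_j /eqP eq_i.
  split; last 2 first.
  - by rewrite -eq_i ltn_subrL (leq_trans _ lt_b).
  - by rewrite -eq_i subKn.
  apply/andP; split; last by rewrite -eq_i eq_j addnBA // addnBAC.
  apply/forallP => m; apply/implyP => /andP[ne_mi ne_mj].
  by have := eqv m;
    rewrite !ffunE !(inj_eq perm_inj) (negPf ne_mi) (negPf ne_mj).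
move=> [/andP[/forallP off /eqP eq_sum] lt_cb /eqP def_k].
have k1 : (k.+1 = b i - c (p i))%N by rewrite def_k prednK // subn_gt0.
have bi : (b i = c (p i) + k.+1)%N by rewrite k1 subnKC // ltnW.
have cj : (c (p j) = b j + k.+1)%N.
  by apply: (@addnI (c (p i))); rewrite -eq_sum bi -!addnA [(k.+1 + _)%N]addnC.
split; first by rewrite bi leq_addl.
  by rewrite cj leq_addl.
apply/forallP => m; rewrite !ffunE !(inj_eq perm_inj).
have := off m; have [->|ne_mi] := eqVneq m i.
  by rewrite (negPf ne_ij) bi addnK.
by have [->|ne_mj] := eqVneq m j; rewrite // cj addnK.
Qed.

Let cross_det i j : i != j ->
  \sum_(p : 'S_l) (-1) ^+ p * (crossed i j p && (c (p i) < b i)%N)%:R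
  + \sum_(p : 'S_l) (-1) ^+ p * (crossed j i p && (c (p j) < b j)%N)%:R
  = - match_det b c.
Proof.
move=> ne_ij.
have crossC p : crossed j i p = crossed i j p.
  rewrite /crossed addnC [X in _ == X]addnC; congr (_ && _).
  by apply: eq_forallb => m; rewrite andbC.
(* composing p with the transposition of i and j preserves the condition and
     changes the sign *)
have sum0 : \sum_(p : 'S_l) (-1) ^+ p * (crossed i j p)%:R = 0 :> algC.
  apply/eqP;
    have := mulrn_eq0 (\sum_(p : 'S_l) (-1) ^+ p * (crossed i j p)%:R : algC) 2.
  rewrite /= => <-; rewrite mulr2n {1}(reindex_inj (mulgI (tperm i j))) /=.
  rewrite -big_split /= big1 // => p _.
  suff -> : crossed i j (tperm i j * p)%g = crossed i j p.
    by rewrite odd_mul_tperm ne_ij signr_addb expr1 mulN1r mulNr addNr.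
  rewrite /crossed !permM tpermL tpermR [X in _ == X]addnC; congr (_ && _).
  apply: eq_forallb => m; case: (boolP (_ && _)) => //= /andP[nmi nmj].
  by rewrite permM tpermD // eq_sym.
apply/eqP;
  rewrite -addr_eq0 -big_split match_detE -big_split /= -[X in _ == X]sum0.
apply/eqP/eq_bigr => p _; rewrite -!mulrDr; congr (_ * _).
have -> : [forall i, b i == c (p i)] = crossed i j p && (b i == c (p i)).
  apply/forallP/andP => [eqv|[/andP[/forallP off eq_sum] eq_i] m].
    split=> //; apply/andP; split; last by rewrite !(eqP (eqv _)).
    by apply/forallP => m; rewrite eqv implybT.
  have := off m; have [-> //|ne_mi] := eqVneq m i.
  by have [-> _|//] := eqVneq m j; rewrite -(eqn_add2l (b i)) {2}(eqP eq_i).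
rewrite crossC; case: (boolP (crossed i j p)) => [/andP[_ /eqP eq_sum]|_] /=.
  have -> : (c (p j) < b j)%N = (b i < c (p i))%N.
    by rewrite -(ltn_add2l (c (p i))) -eq_sum ltn_add2r.
  by case: ltngtP; rewrite ?addr0 ?add0r.
by rewrite !addr0.
Qed.

(** On wedge products of basis vectors e_0, e_1, and so on, let L_k be the sum
  of the operators that lower one index by k. The identity says that the sum
  over k > 0 of the adjoint of L_k after L_k multiplies the wedge product of
  the e_(b i) by the sum of b minus the sum of 0, ..., l - 1. Expand the
  determinants over permutations p, and write j = p i'. The terms with i' = i
  give the sum of b. In a term with i' and i distinct, k is forced, and its
  positivity is the condition c (p i) < b i. Adding the term in which i and i'
  are exchanged turns this condition into c (p i) <> b i. The sum without the
  condition vanishes by antisymmetry under the transposition of i and i', which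
  leaves minus the terms with c (p i) = b i, where p matches b and c completely.
  There is one such contribution for each of the l(l - 1)/2 unordered pairs. *)
Lemma match_det_energy :
  \sum_i \sum_j \sum_(k < K) ((k < b i)%N && (k < c j)%N)%:R
      * match_det (lower b i k.+1) (lower c j k.+1)
  = ((\sum_i b i)%N%:R - 'C(l, 2)%:R) * match_det b c.
Proof.
pose E i j p : algC := \sum_(k < K) (lowered i (p j) k p)%:R.
transitivity (\sum_i \sum_j \sum_(p : 'S_l) (-1) ^+ p * E i j p).
  apply: eq_bigr => i _.
  transitivity (\sum_(p : 'S_l) \sum_j (-1) ^+ p *
                 (\sum_(k < K) (lowered i j k p)%:R) : algC).
    rewrite [RHS]exchange_big; apply: eq_bigr => j _.
    rewrite [RHS](eq_bigr
      (fun p => \sum_(k < K) (-1) ^+ p * (lowered i j k p)%:R : algC));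
      last by move=> p _; rewrite mulr_sumr.
    rewrite [RHS]exchange_big; apply: eq_bigr => k _.
    rewrite match_detE mulr_sumr; apply: eq_bigr => p _.
    by rewrite mulrCA -natrM mulnb -andbA.
  rewrite [RHS]exchange_big; apply: eq_bigr => p _.
  by rewrite (reindex_inj (@perm_inj _ p)).
rewrite (eq_bigr (fun i => (b i)%:R * match_det b c
   + \sum_(j | j != i) \sum_(p : 'S_l)
        (-1) ^+ p * (crossed i j p && (c (p i) < b i)%N)%:R)); last first.
  move=> i _; rewrite (bigD1 i) //=; congr (_ + _).
    rewrite match_detE mulr_sumr; apply: eq_bigr => p _; rewrite mulrCA;
      congr (_ * _).
    rewrite /E
      (eq_bigr (fun k : 'I_K => ((k < b i)%N : nat)%:R * (matched p)%:R)).
      by rewrite -mulr_suml -natr_sum sum_ltn.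
    by move=> k _; rewrite lowered_diag -natrM mulnb andbC.
  apply: eq_bigr => j ne_ji; apply: eq_bigr => p _; congr (_ * _).
  rewrite /E; case: (boolP (_ && _)) => [/andP[cross lt_cb]|notc].
    have lt_K : ((b i - c (p i)).-1 < K)%N.
      by rewrite prednK ?subn_gt0 // (leq_trans (leq_subr _ _)).
    rewrite (bigD1 (Ordinal lt_K)) //= lowered_cross 1?eq_sym // cross lt_cb
      eqxx.
    rewrite big1 ?addr0 // => k ne_k; rewrite lowered_cross 1?eq_sym //.
    by rewrite cross lt_cb; case: eqP => // eq_k; case/eqP: ne_k;
      apply: val_inj.
  rewrite big1 // => k _; rewrite lowered_cross 1?eq_sym // andbA.
  by rewrite (negPf notc).
rewrite big_split /= -mulr_suml -natr_sum mulrBl; congr (_ + _).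
apply/eqP; rewrite -(inj_eq (mulIf (_ : 2%:R != 0))) ?pnatr_eq0 //; apply/eqP.
rewrite mulr_natr mulr2n.
rewrite {2}(exchange_big_dep predT) //= -big_split /=.
rewrite (eq_bigr (fun i => \sum_(j | j != i) - match_det b c)); last first.
  move=> i _; under [X in _ + X]eq_bigl => j do rewrite eq_sym.
  by rewrite -big_split /=; apply: eq_bigr => j ne_ji;
    rewrite cross_det // eq_sym.
under eq_bigr => i _ do rewrite sumr_const cardC1 card_ord.
rewrite sumr_const card_ord.
rewrite -mulrnA mulnC -[(_ * _)%N]/(l * l.-1)%N -[l.-1]bin1 mul_bin_diag.
by rewrite mulNr mulr_natl mulr_natr -mulrnA mulnC mulNrn.
Qed.

End Energy.

End MatchDet.

(** * Signed counts of matrices with given margins *)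

Section Multiplicities.

Variables (C : finType) (N : nat).
Implicit Types (a : {ffun C -> nat}) (c d : C).

Definition raise a c k : {ffun C -> nat} :=
  [ffun d => if d == c then (a d + k)%N else a d].

Definition sum_mults n (f : {ffun C -> nat} -> algC) : algC :=
  \sum_(A : {ffun C -> 'I_N.+1} | (\sum_c A c)%N == n) f [ffun c => A c : nat].

Let sum_raise c k n (f : {ffun C -> nat} -> algC) : (n <= N)%N ->
  \sum_(A : {ffun C -> 'I_N.+1} | ((\sum_d A d)%N == n) && (k < A c)%N)
      f [ffun d => A d : nat]
  = \sum_(A : {ffun C -> 'I_N.+1} | ((\sum_d A d) + k.+1)%N == n)
      f (raise [ffun d => A d : nat] c k.+1).
Proof.
move=> le_nN.
pose up (A : {ffun C -> 'I_N.+1}) : {ffun C -> 'I_N.+1} :=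
  [ffun d => if d == c then inord (A d + k.+1) else A d].
pose down (A : {ffun C -> 'I_N.+1}) : {ffun C -> 'I_N.+1} :=
  [ffun d => if d == c then inord (A d - k.+1) else A d].
have sum_up (A : {ffun C -> 'I_N.+1}) : (A c + k.+1 < N.+1)%N ->
    ((\sum_d up A d) = (\sum_d A d) + k.+1)%N.
  move=> ltN; rewrite (bigD1 c) //= [in RHS](bigD1 c) //= ffunE eqxx inordK //.
  rewrite addnAC; congr (_ + _ + _)%N.
  by apply: eq_bigr => d /negPf ne_dc; rewrite ffunE ne_dc.
have downK (A : {ffun C -> 'I_N.+1}) : (k < A c)%N -> up (down A) = A.
  move=> lt_kA; apply/ffunP => d; rewrite !ffunE; have [->|//] := eqVneq d c.
  rewrite inordK ?subnK ?inord_val //.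
  by rewrite ltnS (leq_trans (leq_subr _ _)) // -ltnS.
rewrite (reindex_onto up down) => [|A /andP[_ /downK] //].
have le_c (A : {ffun C -> 'I_N.+1}) : (A c <= \sum_d A d)%N
  by rewrite (bigD1 c) //= leq_addr.
apply: eq_big => [A|A /andP[/andP[_ lt_kA] /eqP upK]].
  apply/idP/idP => [/andP[/andP[/eqP sumA lt_kA] /eqP upK]|/eqP sumA].
    rewrite -{1}upK -sumA.
    have downc : (down (up A) c = up A c - k.+1 :> nat)%N.
      rewrite ffunE eqxx inordK // ltnS (leq_trans (leq_subr _ _)) //.
      by rewrite -ltnS.
    rewrite (bigD1 c) //= [X in _ == X](bigD1 c) //= downc addnAC subnK //.
    by rewrite eqn_add2l; apply/eqP/eq_bigr => d /negPf ne_dc;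
      rewrite ffunE ne_dc.
  have ltN : (A c + k.+1 < N.+1)%N.
    by rewrite ltnS (leq_trans _ le_nN) // -sumA leq_add2r le_c.
  have upc : (up A c = A c + k.+1 :> nat)%N by rewrite ffunE eqxx inordK.
  rewrite sum_up // sumA eqxx upc leq_addl /=; apply/eqP/ffunP => d.
  rewrite [LHS]ffunE; have [->|ne_dc] := eqVneq d c;
    last by rewrite ffunE (negPf ne_dc).
  by rewrite upc addnK inord_val.
congr (f _); apply/ffunP => d; rewrite ![in RHS]ffunE [LHS]ffunE.
have [->|ne_dc] := eqVneq d c; last by rewrite ffunE (negPf ne_dc).
rewrite -{2}upK [down _ _]ffunE eqxx inordK ?subnK //.
by rewrite ltnS (leq_trans (leq_subr _ _)) // -ltnS.
Qed.

(** Count the n units of a multiplicity vector: the unit number k of the letter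
  c is present exactly if the vector is obtained by raising another one by k.+1
  at c. *)
Lemma sum_mults_rec n f K : (n <= N)%N -> (N <= K)%N ->
  n%:R * sum_mults n f = \sum_c \sum_(k < K)
    \sum_(A : {ffun C -> 'I_N.+1} | ((\sum_d A d) + k.+1)%N == n)
       f (raise [ffun d => A d : nat] c k.+1).
Proof.
move=> le_nN le_NK; rewrite mulr_sumr.
rewrite (eq_bigr (fun A : {ffun C -> 'I_N.+1} => \sum_c \sum_(k < K)
    (k < A c)%N%:R * f [ffun d => A d : nat])); last first.
  move=> A /eqP <-; rewrite natr_sum mulr_suml; apply: eq_bigr => c _.
  by rewrite -mulr_suml -natr_sum sum_ltn // (leq_trans _ le_NK) // -ltnS.
rewrite exchange_big; apply: eq_bigr => c _ /=.
rewrite exchange_big; apply: eq_bigr => k _ /=.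
rewrite -sum_raise // [RHS]big_mkcondr /=; apply: eq_bigr => A _.
by case: ltnP; rewrite ?mul1r ?mul0r.
Qed.

End Multiplicities.

Section Orthogonality.

Variable l : nat.
Implicit Types (b c x : {ffun 'I_l -> nat}) (i j : 'I_l) (k n : nat).

Definition stair : {ffun 'I_l -> nat} := [ffun i => rev_ord i : nat].

(** The signed number of permutations s such that x and the permuted staircase
  add up to b. *)
Definition stair_det x b : algC :=
  \det (\matrix_(i, j) (x i + stair j == b i)%N%:R).

Lemma sum_stair : (\sum_i stair i = 'C(l, 2))%N.
Proof.
rewrite -bin2_sum big_mkord (reindex_inj rev_ord_inj); apply: eq_bigr => i _.
by rewrite ffunE rev_ordK.
Qed.

Lemma stair_det_raise x b i k :
  stair_det (raise x i k) b = (k <= b i)%:R * stair_det x (lower b i k).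
Proof.
have [le_kb|lt_bk] := leqP; last first.
  rewrite mul0r /stair_det (expand_det_row _ i) big1 // => j _.
  rewrite mxE ffunE eqxx addnAC (_ : (_ == _) = false) ?mul0r //.
  by apply/negbTE; rewrite neq_ltn (leq_trans lt_bk) ?orbT // leq_addl.
rewrite mul1r; congr (\det _); apply/matrixP => m j; rewrite !mxE !ffunE.
have [->|//] := eqVneq m i.
by rewrite -[in RHS](eqn_add2r k) subnK // addnAC.
Qed.

Lemma match_det_sum_neq b c :
  (\sum_i b i)%N != (\sum_i c i)%N -> match_det b c = 0.
Proof.
move=> ne_bc; rewrite match_detE big1 // => p _.
case: forallP => [eq_bc|]; last by rewrite mulr0.
case/eqP: ne_bc; rewrite [RHS](reindex_inj (@perm_inj _ p)).
by apply: eq_bigr => i _; apply/eqP.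
Qed.

Lemma stair_det0 b : stair_det [ffun=> 0%N] b = match_det b stair.
Proof.
by congr (\det _); apply/matrixP => i j; rewrite !mxE ffunE add0n eq_sym.
Qed.

(** Equality case of [sum_distinct_ge]. *)
Lemma perm_stair b : injective b -> (\sum_i b i = 'C(l, 2))%N ->
  {p : 'S_l | forall i, b i = stair (p i)}.
Proof.
move=> b_inj sum_b.
have b_lt i : (b i < l)%N.
  have := @sum_distinct_min _ [set: 'I_l] b (in2W b_inj);
    rewrite cardsT card_ord.
  apply; last by rewrite inE.
  by rewrite -sum_b; apply/eq_leq/eq_bigl => j; rewrite inE.
pose f i := rev_ord (Ordinal (b_lt i)).
have f_inj : injective f by move=> i j /rev_ord_inj[/b_inj].
by exists (perm f_inj) => i; rewrite permE ffunE rev_ordK.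
Qed.

Lemma match_det_stair b c :
  match_det b stair * match_det c stair
  = ((\sum_i b i)%N == 'C(l, 2))%:R * match_det b c.
Proof.
case: (boolP (injectiveb b)) => [/injectiveP b_inj|/injectiveP b_ninj];
  last first.
  by rewrite !(match_det_ninj _ b_ninj) mul0r mulr0.
case: (boolP (injectiveb c)) => [/injectiveP c_inj|/injectiveP c_ninj];
  last first.
  by rewrite (match_det_sym b c) !(match_det_ninj _ c_ninj) !mulr0.
have [sum_b|ne_b] := eqVneq (\sum_i b i)%N 'C(l, 2); last first.
  rewrite (match_det_sum_neq (b := b)) ?sum_stair //.
  by rewrite mulr0n !mul0r.
have [sum_c|ne_c] := eqVneq (\sum_i c i)%N 'C(l, 2); last first.
  rewrite (match_det_sum_neq (b := c)) ?sum_stair // mulr0.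
  by rewrite match_det_sum_neq ?mulr0 // sum_b eq_sym.
have [p def_b] := perm_stair b_inj sum_b.
have [q def_c] := perm_stair c_inj sum_c.
rewrite (match_det_perm b_inj def_b) (match_det_perm c_inj def_c) mul1r.
rewrite (match_det_perm (p := (p * q^-1)%g) b_inj) => [|i].
  by rewrite odd_permM odd_permV signr_addb.
by rewrite def_c permM permKV.
Qed.

Definition rows (a : {ffun 'I_l * 'I_l -> nat}) : {ffun 'I_l -> nat} :=
  [ffun i => \sum_j a (i, j)]%N.
Definition cols (a : {ffun 'I_l * 'I_l -> nat}) : {ffun 'I_l -> nat} :=
  [ffun j => \sum_i a (i, j)]%N.

Lemma rows_raise a i j k : rows (raise a (i, j) k) = raise (rows a) i k.
Proof.
apply/ffunP => m; rewrite !ffunE; have [->|ne_mi] := eqVneq m i.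
  rewrite (bigD1 j) //= [in RHS](bigD1 j) //= ffunE eqxx addnAC.
  congr (_ + _ + _)%N; apply: eq_bigr => h ne_hj.
  by rewrite ffunE xpair_eqE (negPf ne_hj) andbF.
by apply: eq_bigr => h _; rewrite ffunE xpair_eqE (negPf ne_mi).
Qed.

Lemma cols_raise a i j k : cols (raise a (i, j) k) = raise (cols a) j k.
Proof.
apply/ffunP => m; rewrite !ffunE; have [->|ne_mj] := eqVneq m j.
  rewrite (bigD1 i) //= [in RHS](bigD1 i) //= ffunE eqxx addnAC.
  congr (_ + _ + _)%N; apply: eq_bigr => h ne_hi.
  by rewrite ffunE xpair_eqE (negPf ne_hi).
by apply: eq_bigr => h _; rewrite ffunE xpair_eqE (negPf ne_mj) andbF.
Qed.

(** Cauchy's formula for the determinant of the 1/(1 - x_i y_j), coefficient by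
  coefficient: it is the product of all 1/(1 - x_i y_j) times the Vandermonde
  determinants of x and y. Both sides satisfy the same recursion in n, by
  [sum_mults_rec] and [match_det_energy]. *)
Lemma sum_stair_det N n b c : (n <= N)%N ->
  sum_mults N n (fun a => stair_det (rows a) b * stair_det (cols a) c)
  = ((\sum_i b i)%N == (n + 'C(l, 2))%N)%:R * match_det b c.
Proof.
elim/ltn_ind: n => n IHn in b c * => le_nN.
(* for n = 0, only the zero matrix contributes *)
have [->|n_gt0] := posnP n.
  rewrite /sum_mults (bigD1 [ffun=> ord0]) /=; last first.
    by rewrite big1 // => d _; rewrite ffunE.
  rewrite big1 ?addr0 => [|A /andP[]]; last first.
    rewrite sum_nat_eq0 => /forallP A0 /eqP[]; apply/ffunP => d.
    by apply/val_inj/eqP; rewrite ffunE; have := A0 d.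
  rewrite add0n -match_det_stair; congr (_ * _).
    rewrite -stair_det0; congr (stair_det _ _); apply/ffunP => i.
    by rewrite !ffunE big1 // => j _; rewrite !ffunE.
  rewrite -stair_det0; congr (stair_det _ _); apply/ffunP => i.
  by rewrite !ffunE big1 // => j _; rewrite !ffunE.
have nz_n : n%:R != 0 :> algC by rewrite pnatr_eq0 -lt0n.
apply: (mulfI nz_n).
(* K bounds the multiplicities as well as the entries of b *)
pose K := (N + \sum_i b i)%N.
rewrite (@sum_mults_rec _ _ _ _ K) ?leq_addr //.
rewrite -(pair_big predT predT (fun i j => \sum_(k < K)
   \sum_(A : {ffun 'I_l * 'I_l -> 'I_N.+1} | ((\sum_d A d) + k.+1)%N == n)
     (stair_det (rows (raise [ffun d => A d : nat] (i, j) k.+1)) b *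
      stair_det (cols (raise [ffun d => A d : nat] (i, j) k.+1)) c))) /=.
pose B : algC := ((\sum_i b i)%N == (n + 'C(l, 2))%N)%:R.
transitivity (B * \sum_i \sum_j \sum_(k < K) ((k < b i)%N && (k < c j)%N)%:R
      * match_det (lower b i k.+1) (lower c j k.+1)).
  rewrite mulr_sumr; apply: eq_bigr => i _; rewrite mulr_sumr;
    apply: eq_bigr => j _.
  rewrite mulr_sumr; apply: eq_bigr => k _.
  under eq_bigr => A _ do rewrite rows_raise cols_raise !stair_det_raise
    mulrACA -natrM mulnb.
  rewrite -mulr_sumr [RHS]mulrCA.
  case: (boolP (_ && _)) => [/andP[lt_kb lt_kc]|_]; last by rewrite !mul0r.
  rewrite !mul1r; have [lt_kn|le_nk] := ltnP k n.
    have lt_n : (n - k.+1 < n)%N by rewrite ltn_subrL.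
    have := IHn _ lt_n (lower b i k.+1) (lower c j k.+1)
      (leq_trans (ltnW lt_n) le_nN).
    rewrite -[(\sum_m lower _ _ _ m == _)%N](eqn_add2r k.+1) sum_lower
      // addnAC subnK //.
    move=> <-; apply: eq_bigl => A; rewrite -[in RHS](eqn_add2r k.+1) subnK //.
  rewrite big1 => [|A /eqP sumA]; last first.
    by move: le_nk; rewrite -sumA addnS ltnNge leq_addl.
  rewrite /B; case: eqP => [sum_b|_]; last by rewrite mulr0n mul0r.
  (* the lowered vector has too small a sum to be injective *)
  rewrite match_det_ninj ?mulr0 // => low_inj.
  have := @sum_distinct_ge _ [set: 'I_l] _ (in2W low_inj);
    rewrite cardsT card_ord.
  rewrite (eq_bigl predT) => [|m]; last by rewrite inE.
  rewrite -(leq_add2r k.+1) sum_lower // sum_b addnC leq_add2r leqNgt ltnS.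
  by rewrite le_nk.
rewrite match_det_energy => [|i]; last first.
  by rewrite (leq_trans _ (leq_addl _ _)) // (bigD1 i) //= leq_addr.
rewrite /B mulrCA; case: eqP => [->|_]; last by rewrite mulr0n !mul0r !mulr0.
by rewrite natrD addrK.
Qed.

End Orthogonality.

(** * Permutation characters and determinantal characters *)

Section PermChar.

Variables (n : nat) (C : finType).
Implicit Types (a : {ffun C -> nat}) (w : {ffun 'I_n -> C}) (g : 'S_n).

(** The permutation character on the words of content a, taken to be 0 when
  there are no such words. *)
Definition perm_char a : 'CF([set: 'S_n]) :=
  if [pick w : {ffun 'I_n -> C} | content w == a] is Some w
  then 'Ind[[set: 'S_n], stab w] 1 else 0.

Lemma cfInd_stabE w g :
  'Ind[[set: 'S_n], stab w] 1 g
  = \sum_(v : {ffun 'I_n -> C} | wact v g == v) (content v == content w)%:R.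
Proof.
rewrite cfIndE ?subsetT //.
apply: (mulfI (neq0CG (stab w))); rewrite mulVKf ?neq0CG // mulr_sumr.
rewrite [RHS]big_mkcond [RHS](bigID (fun v => content v == content w)) /=.
rewrite [X in _ = _ + X]big1 ?addr0 => [|v /negPf->];
  last by rewrite mulr0 if_same.
rewrite (partition_big (wact w) (fun v => content v == content w)) /=;
  last first.
  by move=> y _; rewrite content_wact.
apply: eq_bigr => v /eqP/esym/eq_content_wact[h ->].
rewrite content_wact eqxx mulr1 -(card_transporter w h) -sum1dep_card natr_sum.
rewrite (eq_bigl (fun y => wact w y == wact w h)) => [|y]; last by rewrite inE.
case: ifP => fix_g; last first.
  rewrite big1 // => y /eqP wy; rewrite cfun1E inE /conjg !wactM wy.
  by rewrite -(inj_eq (@wact_inj _ _ y)) -wactM mulgV wact1 wy fix_g.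
rewrite big_mkcond [RHS]big_mkcond; apply: eq_bigr => y _.
case: eqP => // wy; rewrite cfun1E inE /conjg !wactM wy (eqP fix_g) -wy -wactM.
by rewrite mulVg wact1 eqxx.
Qed.

Lemma perm_charE a g :
  perm_char a g = \sum_(w : {ffun 'I_n -> C} | wact w g == w)
    (content w == a)%:R.
Proof.
rewrite /perm_char; case: pickP => [w /eqP <- | no_w]; first exact: cfInd_stabE.
by rewrite cfunE big1 // => w _; rewrite no_w.
Qed.

Lemma perm_char_Ind w : perm_char (content w) = 'Ind[[set: 'S_n], stab w] 1.
Proof. by apply/cfunP => g; rewrite perm_charE cfInd_stabE. Qed.

Lemma perm_char_char a : perm_char a \is a character.
Proof.
rewrite /perm_char; case: pickP => [w _|_]; last exact: cfun0_char.
by rewrite cfInd_char // cfun1_char.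
Qed.

Lemma cfdot_perm_char w (phi : 'CF([set: 'S_n])) :
  '[phi, perm_char (content w)] =
     #|stab w|%:R^-1 * \sum_(g in stab w) phi g.
Proof.
rewrite perm_char_Ind -cfdot_Res_l cfdotE; congr (_ * _).
apply: eq_bigr => g stab_g.
by rewrite cfResE ?subsetT // cfun1E stab_g conjC1 mulr1.
Qed.

End PermChar.

Section DetChar.

Variables (n l : nat).
Implicit Types (b c : {ffun 'I_l -> nat}) (w : {ffun 'I_n -> 'I_l}) (g : 'S_n).
Implicit Type (s : 'S_l).

Lemma stair_detE x b : stair_det x b
  = \sum_(s : 'S_l) (-1) ^+ s * [forall i, x i + stair l (s i) == b i]%N%:R.
Proof.
apply: eq_bigr => p _; rewrite -prod_natb; congr (_ * _).
by apply: eq_bigr => i _; rewrite mxE.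
Qed.

Lemma stair_det_real x b : stair_det x b \is Num.real.
Proof. by rewrite stair_detE rpred_sum // => s _;
  rewrite rpredM ?rpred_sign ?rpred_nat. Qed.

(** The value [None] stands for a vector with a negative entry; it contributes
  no permutation character. *)
Definition stair_sub b s : option {ffun 'I_l -> nat} :=
  if [forall i, stair l (s i) <= b i]%N
  then Some [ffun i => b i - stair l (s i)]%N else None.

(** The expansion of the Jacobi-Trudi determinant; for a partition with l
  nonzero parts and b its beta-numbers, b lists the hook lengths in the first
  column. *)
Definition det_char b : 'CF([set: 'S_n]) :=
  \sum_(s : 'S_l) (-1) ^+ s *: oapp (@perm_char n _) 0 (stair_sub b s).

Lemma stair_subE b s g :
  (oapp (@perm_char n _) 0 (stair_sub b s) : 'CF([set: 'S_n])) g
  = \sum_(w | wact w g == w)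
      [forall i, content w i + stair l (s i) == b i]%N%:R.
Proof.
rewrite /stair_sub;
  case: (boolP [forall i, _]) => [/forallP le_sb|/forallPn[i]] /=.
  rewrite perm_charE; apply: eq_bigr => w _; congr (nat_of_bool _)%:R.
  apply/eqP/forallP => [-> i|eq_b]; first by rewrite ffunE subnK.
  by apply/ffunP => i; rewrite [RHS]ffunE -(eqP (eq_b i)) addnK.
rewrite -ltnNge => lt_bs; rewrite cfunE big1 // => w _.
case: forallP => // /(_ i)/eqP eq_b; move: lt_bs.
by rewrite -eq_b ltnNge leq_addl.
Qed.

Lemma det_charE b g :
  det_char b g = \sum_(w | wact w g == w) stair_det (content w) b.
Proof.
rewrite sum_cfunE; under [RHS]eq_bigr => w _ do rewrite stair_detE.
rewrite [RHS]exchange_big; apply: eq_bigr => s _.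
by rewrite cfunE stair_subE mulr_sumr.
Qed.

Lemma det_char_real b g : det_char b g \is Num.real.
Proof. by rewrite det_charE rpred_sum // => w _; apply: stair_det_real. Qed.

Let pair_words (ww : {ffun 'I_n -> 'I_l} * {ffun 'I_n -> 'I_l}) :
  {ffun 'I_n -> 'I_l * 'I_l} := [ffun x => (ww.1 x, ww.2 x)].

Let rows_content ww : rows (content (pair_words ww)) = content ww.1.
Proof.
apply/ffunP => i; rewrite !ffunE -sum1_card.
rewrite (partition_big ww.2 predT) //=; apply: eq_bigr => j _.
rewrite ffunE -sum1_card; apply: eq_bigl => x.
by rewrite !inE ffunE xpair_eqE.
Qed.

Let cols_content ww : cols (content (pair_words ww)) = content ww.2.
Proof.
apply/ffunP => i; rewrite !ffunE -sum1_card.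
rewrite (partition_big ww.1 predT) //=; apply: eq_bigr => j _.
rewrite ffunE -sum1_card; apply: eq_bigl => x.
by rewrite !inE ffunE xpair_eqE andbC.
Qed.

(** A pair of words is a word over pairs of letters, whose content is a matrix
  with the contents of the two words as its margins. Burnside's lemma then
  reduces the claim to [sum_stair_det]. *)
Theorem cfdot_det_char b c : '[det_char b, det_char c] =
  ((\sum_i b i)%N == (n + 'C(l, 2))%N)%:R * match_det b c.
Proof.
rewrite cfdotE cardsT card_Sn -(sum_stair_det b c (leqnn n)).
apply: (mulfI (_ : n`!%:R != 0)); first by rewrite pnatr_eq0 -lt0n fact_gt0.
rewrite mulVKf ?pnatr_eq0 -?lt0n ?fact_gt0 // -burnside //.
rewrite big_mkcond; apply: eq_bigr => g _; rewrite inE.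
rewrite (conj_Creal (det_char_real _ _)) !det_charE mulr_suml.
under eq_bigr do rewrite mulr_sumr.
(* a pair of words fixed by g is a word over pairs fixed by g *)
rewrite pair_big (reindex (fun u : {ffun 'I_n -> 'I_l * 'I_l} =>
   ([ffun x => (u x).1], [ffun x => (u x).2]))) /=; last first.
  exists pair_words => [u|[w v]] _; first by apply/ffunP => x;
    rewrite !ffunE -surjective_pairing.
  by congr pair; apply/ffunP => x; rewrite !ffunE.
apply: eq_big => [u|u _].
  apply/andP/eqP => [[/eqP/ffunP fix1 /eqP/ffunP fix2]|/ffunP fixu].
    apply/ffunP => x; rewrite ffunE; have := fix1 x; have := fix2 x.
    by rewrite !ffunE; case: (u x) (u _) => ? ? [? ?] /= -> ->.
  by split; apply/eqP/ffunP => x; rewrite !ffunE -[in RHS]fixu ffunE.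
have eq_u : u = pair_words ([ffun x => (u x).1], [ffun x => (u x).2]).
  by apply/ffunP => x; rewrite !ffunE -surjective_pairing.
by rewrite [in RHS]eq_u rows_content cols_content.
Qed.

Lemma det_char_ninj b : ~ injective b -> det_char b = 0.
Proof.
move=> b_ninj; apply/eqP.
by rewrite -cfnorm_eq0 cfdot_det_char (match_det_ninj _ b_ninj) mulr0.
Qed.

End DetChar.

(** * Twisting by the sign character *)

Section SignChar.

Variable n : nat.

Fact sign_mx_repr :
  mx_repr [set: 'S_n] (fun g : 'S_n => ((-1) ^+ odd_perm g)%:M : 'M[algC]_1).
Proof.
split=> [|g h _ _]; first by rewrite odd_perm1.
by rewrite -scalar_mxM odd_permM signr_addb.
Qed.

Lemma sign_charE g : sign_char n g = (-1) ^+ odd_perm g.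
Proof. by rewrite cfunE. Qed.

Lemma sign_char_char : sign_char n \is a character.
Proof.
apply/char_reprP; exists (Representation (MxRepresentation sign_mx_repr)).
by apply/cfunP => g;
  rewrite [RHS]cfunE inE sign_charE /= mxtrace_scalar !mulr1n.
Qed.

(** If a letter occurs twice, the transposition of two of its positions cancels
  the signs in the stabiliser. *)
Lemma sum_sign_stab (C : finType) (u : {ffun 'I_n -> C}) :
  \sum_(g | wact u g == u) (-1) ^+ odd_perm g = (injectiveb u)%:R :> algC.
Proof.
case: injectiveP => [u_inj | /injectiveP/injectivePn[x [y ne_xy eq_u]]].
  rewrite (big_pred1 1%g) ?odd_perm1 // => g.
  apply/eqP/eqP => [/ffunP fixu | ->]; last exact: wact1.
  by apply/permP => x; apply: u_inj; have := fixu x; rewrite ffunE perm1.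
set S := \sum_(g | _) _; apply/eqP.
have eqS : S = - S.
  rewrite {1}/S (reindex_inj (mulgI (tperm x y))) /S -sumrN.
  apply: eq_big => [g|g _];
    last by rewrite odd_permM odd_tperm ne_xy signr_addb mulN1r.
  have ut : wact u (tperm x y) = u.
    by apply/ffunP => z; rewrite ffunE; case: tpermP => // ->.
  by rewrite wactM -{2}ut (inj_eq (@wact_inj _ _ _)).
by move: eqS => /eqP; rewrite -addr_eq0 -mulr2n mulrn_eq0.
Qed.

Lemma perm_char_real (C : finType) (a : {ffun C -> nat}) g :
  perm_char n a g \is Num.real.
Proof. by rewrite perm_charE rpred_sum // => w _; apply: rpred_nat. Qed.

Variables C1 C2 : finType.
Implicit Type u : {ffun 'I_n -> C1 * C2}.

Definition fst_word u : {ffun 'I_n -> C1} := [ffun x => (u x).1].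
Definition snd_word u : {ffun 'I_n -> C2} := [ffun x => (u x).2].

(** The sign removes the pairs of words with a repeated pair of letters: what
  remains are matrices with entries 0 and 1. *)
Lemma cfdot_perm_sign_char (a1 : {ffun C1 -> nat}) (a2 : {ffun C2 -> nat}) :
  '[perm_char n a1, sign_char n * perm_char n a2]
  = n`!%:R^-1 *
    #|[set u : {ffun 'I_n -> C1 * C2} |
      [&& injectiveb u, content (fst_word u) == a1
                                & content (snd_word u) == a2]]|%:R.
Proof.
rewrite cfdotE cardsT card_Sn; congr (_ * _).
transitivity (\sum_(g : 'S_n) \sum_(u : {ffun 'I_n -> C1 * C2} | wact u g == u)
  (-1) ^+ odd_perm g
    * ((content (fst_word u) == a1) && (content (snd_word u) == a2))%:R : algC).
  rewrite big_mkcond; apply: eq_bigr => g _; rewrite inE cfunE sign_charE.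
  rewrite rmorphM /= rmorph_sign /= (conj_Creal (perm_char_real _ _))
    !perm_charE.
  rewrite mulrCA -[RHS]mulr_sumr; congr (_ * _); rewrite mulr_suml.
  under eq_bigr do rewrite mulr_sumr.
  rewrite pair_big (reindex (fun u => (fst_word u, snd_word u))) /=; last first.
    exists (fun ww : {ffun 'I_n -> C1} * {ffun 'I_n -> C2} =>
      [ffun x => (ww.1 x, ww.2 x)]).
      by move=> u _; apply/ffunP => x; rewrite !ffunE -surjective_pairing.
    by move=> [w v] _; congr pair; apply/ffunP => x; rewrite !ffunE.
  apply: eq_big => [u|u _]; last by rewrite -natrM mulnb.
  apply/andP/eqP => [[/eqP/ffunP fix1 /eqP/ffunP fix2]|/ffunP fixu].
    apply/ffunP => x; rewrite ffunE; have := fix1 x; have := fix2 x.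
    by rewrite !ffunE; case: (u x) (u _) => ? ? [? ?] /= -> ->.
  by split; apply/eqP/ffunP => x; rewrite !ffunE -[in RHS]fixu ffunE.
rewrite (exchange_big_dep predT) //= -sum1dep_card natr_sum [RHS]big_mkcond.
apply: eq_bigr => u _; rewrite -mulr_suml sum_sign_stab -natrM mulnb.
by case: ifP.
Qed.

End SignChar.

(** The inner product is a sum of products of natural numbers; if it is 1, a
  single product is nonzero. *)
Lemma unique_common_constituent (gT : finGroupType) (G : {group gT})
    (phi psi : 'CF(G)) :
  phi \is a character -> psi \is a character -> '[phi, psi] = 1 ->
  exists i : Iirr G, [/\ '[phi, 'chi_i] = 1, '[psi, 'chi_i] = 1
    & forall j, '[phi, 'chi_j] != 0 -> '[psi, 'chi_j] != 0 -> j = i].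
Proof.
move=> char_phi char_psi; rewrite cfdot_sum_irr.
pose m i := Num.trunc '[phi, 'chi_i]; pose k i := Num.trunc '[psi, 'chi_i].
have mE i : '[phi, 'chi_i] = (m i)%:R by rewrite truncnK ?Cnat_cfdot_char_irr.
have kE i : '[psi, 'chi_i] = (k i)%:R by rewrite truncnK ?Cnat_cfdot_char_irr.
rewrite (eq_bigr (fun i => (m i * k i)%N%:R)) => [|i _]; last first.
  by rewrite mE kE conjC_nat natrM.
rewrite -natr_sum => /eqP; rewrite pnatr_eq1 => /sum_nat_eq1[i [_ mk1 mk0]].
move/eqP: mk1; rewrite muln_eq1 => /andP[/eqP mi /eqP ki].
exists i; split=> [||j]; rewrite ?mE ?kE ?mi ?ki // !pnatr_eq0.
have [// |/mk0/(_ isT)/eqP] := eqVneq j i.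
by rewrite muln_eq0 => /orP[] /eqP->; rewrite ?eqxx.
Qed.

(** * The diagram of a partition *)

Section Diagram.

Variables (n l : nat) (la : {ffun 'I_l -> nat}).
Hypothesis la_dec : forall i j : 'I_l, (i <= j)%N -> (la j <= la i)%N.
Hypothesis sum_la : (\sum_i la i = n)%N.

Definition conj_parts : {ffun 'I_n -> nat} :=
  [ffun j : 'I_n => #|[set i | j < la i]%N|].
Definition diagram : {set 'I_l * 'I_n} :=
  [set d : 'I_l * 'I_n | d.2 < la d.1]%N.

Lemma part_le i : (la i <= n)%N.
Proof. by rewrite -sum_la (bigD1 i) //= leq_addr. Qed.

Lemma card_initial m : (m <= l)%N -> #|[set i : 'I_l | i < m]%N| = m.
Proof. by move=> le_ml; rewrite -sum1dep_card big_mkcond /= sum_ltn. Qed.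

Lemma ltn_conj_parts (i : 'I_l) (j : 'I_n) :
  (i < conj_parts j)%N = (j < la i)%N.
Proof.
rewrite ffunE; apply/idP/idP => [lt_i|lt_j].
  rewrite ltnNge; apply: contraL lt_i => le_j; rewrite -leqNgt.
  rewrite -[leqRHS](card_initial (ltnW (ltn_ord i))) subset_leq_card //.
  apply/subsetP => k; rewrite !inE ltnNge => lt_jk; rewrite ltnNge.
  by apply: contra lt_jk => /la_dec/leq_trans->.
rewrite -[ltnLHS](card_initial (ltnW (ltn_ord i))) proper_card //.
apply/properP; split; last by exists i; rewrite inE // ltnn.
by apply/subsetP => k; rewrite !inE => /ltnW/la_dec; apply: leq_trans.
Qed.

Lemma conj_parts_le j : (conj_parts j <= l)%N.
Proof. by rewrite ffunE -[leqRHS]card_ord max_card. Qed.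

Lemma card_diagram_row i : #|[set d in diagram | d.1 == i]| = la i.
Proof.
rewrite -sum1dep_card
  (eq_bigl (fun d : 'I_l * 'I_n => (d.1 == i) && (d.2 < la i)%N)); last first.
  by move=> d; rewrite !inE andbC; case: eqP => // ->.
rewrite -(pair_big (pred1 i) (fun j : 'I_n => j < la i)%N (fun _ _ => 1%N)) /=.
by rewrite big_pred1_eq big_mkcond /= sum_ltn // part_le.
Qed.

Lemma card_diagram_col j : #|[set d in diagram | d.2 == j]| = conj_parts j.
Proof.
rewrite -sum1dep_card
  (eq_bigl (fun d : 'I_l * 'I_n => (j < la d.1)%N && (d.2 == j))); last first.
  by move=> d; rewrite !inE; case: eqP => [->|]; rewrite ?andbF.
rewrite -(pair_big (fun i => j < la i)%N (pred1 j) (fun _ _ => 1%N)) /=.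
under eq_bigr do rewrite big_pred1_eq.
by rewrite sum1dep_card ffunE.
Qed.

Lemma card_diagram : #|diagram| = n.
Proof.
rewrite -sum1_card (partition_big fst predT) //= -[RHS]sum_la.
by apply: eq_bigr => i _; rewrite sum1dep_card card_diagram_row.
Qed.

Lemma sum_conj_parts : (\sum_j conj_parts j = n)%N.
Proof.
rewrite -[RHS]card_diagram -sum1_card (partition_big snd predT) //=.
by apply: eq_bigr => i _; rewrite sum1dep_card card_diagram_col.
Qed.

(** Both sides add the row indices of all boxes: column j fills the rows 0,
  ..., [conj_parts j] - 1. *)
Lemma sum_row_diagram :
  (\sum_(i < l) i * la i = \sum_(j < n) 'C(conj_parts j, 2))%N.
Proof.
transitivity (\sum_(d in diagram) d.1)%N.
  rewrite (partition_big fst predT) //=; apply: eq_bigr => i _.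
  rewrite (eq_bigr (fun=> i : nat)) => [|d /andP[_ /eqP->] //].
  by rewrite sum_nat_cond_const card_diagram_row mulnC.
rewrite (partition_big snd predT) //=; apply: eq_bigr => j _.
rewrite (eq_bigl (fun d : 'I_l * 'I_n => (j < la d.1)%N && (d.2 == j)));
  last first.
  by move=> d; rewrite !inE; case: eqP => [->|]; rewrite ?andbF.
rewrite -(pair_big (fun i => j < la i)%N (pred1 j) (fun i _ => i : nat)) /=.
under eq_bigr do rewrite big_pred1_eq.
under eq_bigl do rewrite -ltn_conj_parts.
by rewrite -bin2_sum -(big_ord_widen _ (fun i => i)) ?conj_parts_le ?big_mkord.
Qed.

Section InjectiveWord.

Variable u : {ffun 'I_n -> 'I_l * 'I_n}.
Hypothesis u_inj : injective u.
Hypothesis u_cols : content (snd_word u) = conj_parts.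

Let col j := [set x | (u x).2 == j].

Let card_col j : #|col j| = conj_parts j.
Proof.
by rewrite -u_cols ffunE; apply: eq_card => x; rewrite !inE ffunE.
Qed.

Let row_inj j : {in col j &, injective (fun x => (u x).1 : nat)}.
Proof.
move=> x y; rewrite !inE => /eqP xj /eqP yj /val_inj eq1.
by apply: u_inj;
  rewrite [LHS]surjective_pairing [RHS]surjective_pairing xj yj eq1.
Qed.

Let row_moment :
  (\sum_(i < l) i * content (fst_word u) i = \sum_j \sum_(x in col j)
    (u x).1)%N.
Proof.
transitivity (\sum_x (u x).1)%N.
  rewrite [RHS](partition_big (fun x => (u x).1) predT) //=;
    apply: eq_bigr => i _.
  rewrite (eq_bigr (fun=> i : nat)) => [|x /eqP-> //].
  rewrite sum_nat_cond_const mulnC ffunE; congr (_ * _)%N.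
  by apply: eq_card => x; rewrite !inE ffunE.
rewrite (partition_big (fun x => (u x).2) predT) //=; apply: eq_bigr => j _.
by apply: eq_bigl => x; rewrite inE.
Qed.

(** The boxes in one column have distinct row indices, whose sum is at least a
  binomial coefficient. The row moment, the sum of all row indices, takes the
  part of the dominance order here. *)
Lemma row_moment_ge :
  (\sum_(i < l) i * la i <= \sum_(i < l) i * content (fst_word u) i)%N.
Proof.
rewrite row_moment sum_row_diagram; apply: leq_sum => j _.
by rewrite -card_col; apply: sum_distinct_ge; apply: row_inj.
Qed.

(** In the equality case every column is filled from the top. *)
Lemma row_moment_min :
  (\sum_(i < l) i * content (fst_word u) i <= \sum_(i < l) i * la i)%N ->
  forall x, u x \in diagram.
Proof.
rewrite row_moment sum_row_diagram => le_moment x.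
have ge_col j : ('C(conj_parts j, 2) <= \sum_(x in col j) (u x).1)%N.
  by rewrite -card_col; apply: sum_distinct_ge; apply: row_inj.
have: (\sum_j (\sum_(x in col j) (u x).1 - 'C(conj_parts j, 2)) == 0)%N.
  by rewrite sumnB // subn_eq0.
rewrite sum_nat_eq0 => /forall_inP/(_ (u x).2 isT).
rewrite subn_eq0 -card_col => /(sum_distinct_min (@row_inj _))/(_ x).
by rewrite !inE eqxx => /(_ isT); rewrite card_col ltn_conj_parts.
Qed.

End InjectiveWord.

Lemma diagram_words : [set u : {ffun 'I_n -> 'I_l * 'I_n} | [&& injectiveb u,
     content (fst_word u) == la & content (snd_word u) == conj_parts]]
  = [set u in ffun_on (mem diagram) | injectiveb u].
Proof.
apply/setP => u; rewrite !inE andbC; case: injectiveP => [u_inj|];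
  last by rewrite !andbF.
rewrite !andbT; apply/andP/ffun_onP => [[/eqP u_rows /eqP u_cols] x|u_diag].
  by apply: row_moment_min => //; rewrite u_rows.
have im_u : u @: [set: 'I_n] = diagram.
  apply/eqP;
    rewrite eqEcard card_imset // cardsT card_ord card_diagram leqnn andbT.
  by apply/subsetP => _ /imsetP[x _ ->].
split; apply/eqP/ffunP => i.
  rewrite ffunE -card_diagram_row -(card_imset _ u_inj) -im_u.
  apply: eq_card => d; apply/imsetP/idP => [[x + ->]|].
    by rewrite !inE ffunE => ->; rewrite andbT; apply/imsetP; exists x.
  by rewrite inE => /andP[/imsetP[x _ ->] eqi]; exists x; rewrite // !inE ffunE.
rewrite ffunE -card_diagram_col -(card_imset _ u_inj) -im_u.
apply: eq_card => d; apply/imsetP/idP => [[x + ->]|].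
  by rewrite !inE ffunE => ->; rewrite andbT; apply/imsetP; exists x.
by rewrite inE => /andP[/imsetP[x _ ->] eqi]; exists x; rewrite // !inE ffunE.
Qed.

(** By minimality of its row moment, the diagram is the only matrix with
  entries 0 and 1 and these margins; its n boxes can be listed in n! orders. *)
Lemma cfdot_perm_sign_conj :
  '[perm_char n la, sign_char n * perm_char n conj_parts] = 1.
Proof.
rewrite cfdot_perm_sign_char diagram_words card_inj_ffuns_on.
by rewrite card_ord card_diagram ffactnn mulVf // pnatr_eq0 -lt0n fact_gt0.
Qed.

End Diagram.

(** * Irreducibility of determinantal characters *)

(** Sum the inequalities 2 i s(i) <= i^2 + s(i)^2, strict unless s(i) = i. *)
Lemma rearrangement l (s : 'S_l) :
  (\sum_(i < l) i * i <= \sum_(i < l) i * s i)%N -> s = 1%g.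
Proof.
move=> le_s; apply/permP => i; rewrite perm1.
have cauchy (k : 'I_l) : true -> (2 * (k * s k) <= k ^ 2 + (s k) ^ 2 ?= iff
  (k == s k :> nat))%N.
  by move=> _; apply: nat_Cauchy.
have /leqifP := leqif_sum cauchy;
  case: ifP => [/forallP/(_ i)/eqP/val_inj //|_].
rewrite ltnNge => /negP[]; rewrite big_split /=.
rewrite -[X in (_ + X <= _)%N](reindex_inj (@perm_inj _ s) (P := predT)
  (F := fun k : 'I_l => (k ^ 2)%N)).
by rewrite addnn -mul2n -big_distrr leq_mul2l le_s.
Qed.

Section IrreducibleDetChar.

Variables (n l : nat) (la : {ffun 'I_l -> nat}).

(** The beta-numbers of la. *)
Definition beta : {ffun 'I_l -> nat} := [ffun i => la i + stair l i]%N.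

Lemma betaE i : beta i = (la i + stair l i)%N.
Proof. by rewrite ffunE. Qed.

Lemma stair_sub1 : stair_sub beta 1%g = Some la.
Proof.
rewrite /stair_sub; case: forallP => [_|[] i];
  last by rewrite perm1 betaE leq_addl.
by congr Some; apply/ffunP => i; rewrite ffunE perm1 betaE addnK.
Qed.

Lemma row_moment_stair_sub s a : stair_sub beta s = Some a ->
  (\sum_(i < l) i * a i + \sum_(i < l) i * i
   = \sum_(i < l) i * la i + \sum_(i < l) i * s i)%N.
Proof.
rewrite /stair_sub; case: forallP => // le_s [<-].
rewrite -!big_split; apply: eq_bigr => i _ /=; rewrite -!mulnDr ffunE.
have := le_s i; rewrite betaE !ffunE /=; have := ltn_ord i;
  have := ltn_ord (s i).
by move=> lt_s lt_i le_si; congr (_ * _)%N; lia.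
Qed.

Hypothesis la_dec : forall i j : 'I_l, (i <= j)%N -> (la j <= la i)%N.
Hypothesis sum_la : (\sum_i la i = n)%N.

Lemma sum_beta : (\sum_i beta i = n + 'C(l, 2))%N.
Proof.
rewrite -sum_la -(sum_stair l) -big_split.
by apply: eq_bigr => i _; rewrite betaE.
Qed.

Lemma beta_mono (i j : 'I_l) : (i < j)%N -> (beta j < beta i)%N.
Proof.
move=> lt_ij; rewrite !ffunE /= -addnS leq_add //; first exact/la_dec/ltnW.
by apply: ltn_sub2l => //; apply: leq_trans (ltn_ord j).
Qed.

Lemma beta_inj : injective beta.
Proof.
move=> i j eq_b; apply: val_inj; case: (ltngtP i j) => // /beta_mono.
  by rewrite eq_b ltnn.
by rewrite eq_b ltnn.
Qed.

(** The vector a has smaller row moment than la, too small for [row_moment_ge].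
  *)
Lemma stair_sub_dominates s a : stair_sub beta s = Some a -> s != 1%g ->
  '[perm_char n a, sign_char n * perm_char n (conj_parts n la)] = 0.
Proof.
move=> /row_moment_stair_sub moment_a ne_s1.
rewrite cfdot_perm_sign_char (_ : [set _ | _] = set0) ?cards0 ?mulr0 //.
apply/setP => u; rewrite !inE.
apply/and3P => [[/injectiveP u_inj /eqP u_rows /eqP u_cols]].
case/eqP: ne_s1; apply: rearrangement.
have := row_moment_ge la_dec sum_la u_inj u_cols; rewrite u_rows.
by move=> ge_a; rewrite -(leq_add2l (\sum_(i < l) i * a i)) moment_a leq_add2r.
Qed.

(** The common constituent of the two characters is orthogonal to all terms of
  the determinant but the diagonal one, so its inner product with the
  determinantal character is 1. Both have norm 1, hence their difference has
  norm 0. *)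
Theorem det_char_irr : exists i : Iirr [set: 'S_n],
  [/\ det_char n beta = 'chi_i,
      '[perm_char n la, 'chi_i] = 1,
      '[sign_char n * perm_char n (conj_parts n la), 'chi_i] = 1
    & forall j, '[perm_char n la, 'chi_j] != 0 ->
        '[sign_char n * perm_char n (conj_parts n la), 'chi_j] != 0 -> j = i].
Proof.
have char_eps : sign_char n * perm_char n (conj_parts n la) \is a character.
  by rewrite rpredM ?sign_char_char ?perm_char_char.
have [i [row_i col_i uniq_i]] := unique_common_constituent (perm_char_char n la)
   char_eps (cfdot_perm_sign_conj la_dec sum_la).
exists i; split=> //; apply/eqP; rewrite -subr_eq0 -cfnorm_eq0 cfnormB.
rewrite cfnorm_irr cfdot_det_char sum_beta eqxx mul1r match_det_same;
  last exact: beta_inj.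
suff -> : '[det_char n beta, 'chi_i] = 1 by rewrite conjC1 subrr.
rewrite cfdot_suml (bigD1 1%g) //= stair_sub1 odd_perm1 scale1r row_i big1
  ?addr0 // => s ne_s1.
rewrite cfdotZl; case def_a: (stair_sub beta s) => [a|] /=;
  last by rewrite cfdot0l mulr0.
apply/eqP; rewrite mulf_eq0 orbC; apply/orP; left; apply: contraT => a_i.
have := stair_sub_dominates def_a ne_s1; rewrite cfdot_sum_irr => /eqP.
rewrite psumr_eq0 => [/allP/(_ i)|j _]; last first.
  by rewrite mulr_ge0 ?conjC_ge0 ?natr_ge0 ?Cnat_cfdot_char_irr ?perm_char_char.
by rewrite mem_index_enum col_i conjC1 mulr1 (negPf a_i) => /(_ isT).
Qed.

End IrreducibleDetChar.

(** * Frobenius-Schur indicators *)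

Lemma idempotent_factor (F : fieldType) n (E : 'M[F]_n) : E *m E = E ->
  exists (u : 'M_(n, \rank E)) (v : 'M_(\rank E, n)), E = u *m v /\ v *m u =
    1%:M.
Proof.
move=> idemE; exists (col_base E), (row_base E); split;
  first by rewrite mulmx_base.
apply: (row_full_inj (col_base_full E));
  apply: (row_free_inj (row_base_free E)).
by rewrite mulmx1 (mulmxA (col_base E)) mulmx_base -mulmxA mulmx_base idemE.
Qed.

Section FrobeniusSchur.

Variables (gT : finGroupType) (G H : {group gT}) (n : nat).
Variable rG : mx_representation algC G n.
Hypothesis absG : mx_absolutely_irreducible rG.
Hypothesis sHG : H \subset G.
Hypothesis realG : forall g, g \in G -> \tr (rG g^-1%g) = \tr (rG g).
Hypothesis trH : \sum_(h in H) \tr (rG h) = #|H|%:R.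

Let nz_n : n%:R != 0 :> algC.
Proof. by case/mx_abs_irrP: absG => n_gt0 _; rewrite pnatr_eq0 -lt0n. Qed.

Let central_scalar (A : 'M[algC]_n) :
  (forall g, g \in G -> A *m rG g = rG g *m A) -> A = (\tr A / n%:R)%:M.
Proof.
move=> cA; have /is_scalar_mxP[a ->] : is_scalar_mx A.
  by apply: (mx_abs_irr_cent_scalar absG); apply/centgmxP.
by rewrite mxtrace_scalar -[a *+ n]mulr_natr mulfK.
Qed.

Let E : 'M[algC]_n := #|H|%:R^-1 *: \sum_(h in H) rG h.

Let HG h : h \in H -> h \in G. Proof. exact: subsetP. Qed.

Let mulE h : h \in H -> E *m rG h = E.
Proof.
move=> Hh; rewrite /E -scalemxAl mulmx_suml; congr (_ *: _).
rewrite [RHS](reindex_inj (mulIg h)) /=; apply: eq_big => [k|k Hk].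
  by rewrite groupMr.
by rewrite repr_mxM ?HG.
Qed.

Let idemE : E *m E = E.
Proof.
rewrite {2}/E -scalemxAr mulmx_sumr.
under eq_bigr => h Hh do rewrite mulE //.
by rewrite sumr_const -scaler_nat scalerA mulVf ?neq0CG // scale1r.
Qed.

Let trE : \tr E = 1.
Proof. by rewrite linearZ /= raddf_sum /= trH mulVf ?neq0CG. Qed.

Let conj_sum X : \sum_(g in G) rG g *m X *m rG g^-1%g =
  (#|G|%:R * \tr X / n%:R)%:M.
Proof.
rewrite [LHS]central_scalar => [|k Gk].
  congr (_ / _)%:M; rewrite raddf_sum /= (eq_bigr (fun=> \tr X)) => [|g Gg].
    by rewrite sumr_const mulr_natl.
  by rewrite mxtrace_mulC mulmxA -repr_mxM ?groupV // mulVg repr_mx1 mul1mx.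
rewrite mulmx_suml mulmx_sumr (reindex_inj (mulgI k)) /=.
apply: eq_big => [g|g]; rewrite groupMl // => Gg.
by rewrite invMg !repr_mxM ?groupV // !mulmxA -!mulmxA -repr_mxM ?groupV
  // mulVg repr_mx1 mulmx1.
Qed.

Let S := \sum_(g in G) rG (g ^+ 2)%g.

Let SE : S = (\tr S / n%:R)%:M.
Proof.
apply: central_scalar => k Gk.
rewrite mulmx_suml mulmx_sumr (reindex_inj (conjg_inj k^-1%g)) /=.
apply: eq_big => [g|g]; rewrite groupJr ?groupV // => Gg.
rewrite -conjXg -!repr_mxM ?groupX ?groupJ ?groupV ?groupX //.
by rewrite conjgE invgK -!mulgA mulVg mulg1.
Qed.

Let spherical : \sum_(g in G) \tr (E *m rG g *m E *m rG g) = \tr S / n%:R.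
Proof.
rewrite (eq_bigr
  (fun g => #|H|%:R^-1 * \sum_(h in H) \tr (E *m rG g *m rG h *m rG g)));
    last first.
  move=> g Gg;
    rewrite {2}/E -scalemxAr -scalemxAl linearZ /= mulmx_sumr mulmx_suml.
  by rewrite raddf_sum.
rewrite -mulr_sumr exchange_big /= (eq_bigr (fun=> \tr S / n%:R)) => [|h Hh];
  last first.
  (* replacing g by h^-1 g turns g h g into h^-1 g^2, and E absorbs h^-1 *)
  have Gh := HG Hh; rewrite (reindex_inj (mulgI h^-1%g)) /=.
  rewrite (eq_big (fun g => g \in G) (fun g => \tr (E *m rG (g ^+ 2)%g)));
    first last.
  - move=> g; rewrite groupMl ?groupV // => Gg.
    have Ghg : (h^-1 * g)%g \in G by rewrite groupM ?groupV.
    rewrite -[LHS]/(\tr (_ *m rG _ *m _ *m rG (h^-1 * g)%g)) -mulmxA -repr_mxM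
      //.
    rewrite mulKVg -mulmxA -repr_mxM // -mulgA repr_mxM ?groupV ?groupM //.
    by rewrite mulmxA (mulE (groupVr Hh)).
  - by move=> g; rewrite groupMl ?groupV.
  by rewrite -raddf_sum /= -mulmx_sumr -/S {1}SE mul_mx_scalar linearZ /= trE
    mulr1.
by rewrite sumr_const -[X in _ * X]mulr_natl mulKf ?neq0CG.
Qed.

(** Let E be the projection to the H-invariants. Its trace is 1 by [trH], so
  that E = u v for a column u and a row v, and m(g) = v rG(g) u is a spherical
  function. Since the character is real, m(g^-1) = m(g). By Schur's lemma the
  sum S of the rG(g^2) is a scalar; averaging over H shows that this scalar is
  the sum of the m(g)^2. On the other hand, the orthogonality of matrix
  coefficients gives the sum of the m(g) m(g^-1) as the order of G divided by
  n. *)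
Lemma frobenius_schur_mult1 : \sum_(g in G) \tr (rG (g ^+ 2)%g) = #|G|%:R.
Proof.
rewrite -raddf_sum -/S; apply: (mulIf (invr_neq0 nz_n)); rewrite -spherical.
have [u [v [defE vu]]] := idempotent_factor idemE.
have rank1 : \rank E = 1%N.
  have := trE; rewrite {1}defE mxtrace_mulC vu mxtrace1.
  by move/eqP; rewrite pnatr_eq1 => /eqP.
move: (\rank E) rank1 u v defE vu => _ -> u v defE vu.
pose m g := (v *m rG g *m u) 0 0.
have vgu g : v *m rG g *m u = (m g)%:M by apply: mx11_scalar.
have trm (A : 'M_n) g : \tr (E *m rG g *m E *m A) = m g * \tr (E *m A).
  transitivity (\tr (u *m (v *m rG g *m u) *m (v *m A)));
    first by rewrite defE !mulmxA.
  by rewrite vgu mul_mx_scalar -scalemxAl linearZ /= mulmxA -defE.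
have mE g : m g = \tr (E *m rG g).
  by rewrite defE -mulmxA mxtrace_mulC vgu mxtrace_scalar.
have mV g : g \in G -> m g^-1%g = m g.
  move=> Gg; rewrite !mE mxtrace_mulC /E -scalemxAr -scalemxAl !linearZ /=;
    congr (_ * _).
  rewrite mulmx_sumr mulmx_suml !raddf_sum /= (reindex_inj invg_inj) /=.
  apply: eq_big => [h|h]; rewrite groupV // => Hh.
  by have Gh := HG Hh; rewrite -!repr_mxM ?groupV // -invMg realG ?groupM.
transitivity (\sum_(g in G) \tr (E *m (rG g *m E *m rG g^-1%g))); last first.
  by rewrite -raddf_sum /= -mulmx_sumr conj_sum mul_mx_scalar linearZ /= trE
    !mulr1.
by apply: eq_bigr => g Gg; rewrite trm -mE -{2}mV // !mulmxA trm -mE.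
Qed.

End FrobeniusSchur.

Lemma indicator_mult1 (gT : finGroupType) (G H : {group gT}) (i : Iirr G) :
  H \subset G -> (forall g, 'chi_i g \is Num.real) ->
  '['Res[H] 'chi_i, 1] = 1 ->
  \sum_(g in G) 'chi_i (g ^+ 2)%g = #|G|%:R.
Proof.
move=> sHG chi_real mult1.
have chiE g : g \in G -> 'chi_i g = \tr ('Chi_i g).
  by move=> Gg; rewrite -irrRepr cfunE Gg.
rewrite (eq_bigr (fun g => \tr ('Chi_i (g ^+ 2)%g))) => [|g Gg];
  last by rewrite chiE ?groupX.
apply: (frobenius_schur_mult1 _ sHG).
- exact/groupC/socle_irr.
- move=> g Gg; rewrite -!chiE ?groupV // char_inv ?irr_char //.
  by rewrite conj_Creal.
apply: (mulfI (invr_neq0 (neq0CG H))); rewrite mulVf ?neq0CG //.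
rewrite -[RHS]mult1 cfdotE; congr (_ * _); apply: eq_bigr => h Hh.
by rewrite cfResE // cfun1E Hh conjC1 mulr1 chiE ?(subsetP sHG).
Qed.

(** * Strictly decreasing beta-numbers *)

Section DecreasingVectors.

Variable l : nat.
Implicit Types b c : {ffun 'I_l -> nat}.

Definition strict_dec b := forall i j : 'I_l, (i < j)%N -> (b j < b i)%N.

Lemma strict_dec_inj b : strict_dec b -> injective b.
Proof.
move=> b_dec i j eq_b; apply: val_inj; case: (ltngtP i j) => // /b_dec.
  by rewrite eq_b ltnn.
by rewrite eq_b ltnn.
Qed.

Lemma increasing_perm1 (p : 'S_l) :
  (forall i j : 'I_l, (i < j)%N -> (p i < p j)%N) -> p = 1%g.
Proof.
move=> p_inc; apply: rearrangement; apply: leq_sum => i _.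
rewrite leq_mul2l; apply/orP; right.
rewrite -[leqLHS](card_initial (ltnW (ltn_ord i)))
  -[leqRHS](card_initial (ltnW (ltn_ord (p i)))).
rewrite -(card_imset _ (@perm_inj _ p)) subset_leq_card //.
by apply/subsetP => _ /imsetP[j + ->]; rewrite !inE; apply: p_inc.
Qed.

Lemma match_det_dec b c : strict_dec b -> strict_dec c -> match_det b c =
  (b == c)%:R.
Proof.
move=> b_dec c_dec; have [->|ne_bc] := eqVneq b c.
  by rewrite match_det_same //; apply: strict_dec_inj.
rewrite match_detE big1 // => p _; case: forallP => [eq_bc|];
  last by rewrite mulr0.
case/eqP: ne_bc; have p1 : p = 1%g.
  apply: increasing_perm1 => i j /b_dec;
    rewrite (eqP (eq_bc i)) (eqP (eq_bc j)).
  have [//|lt_p|/val_inj->] := ltngtP (p i) (p j); last by rewrite ltnn.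
  by move/(ltn_trans (c_dec _ _ lt_p)); rewrite ltnn.
by apply/ffunP => i; rewrite (eqP (eq_bc i)) p1 perm1.
Qed.

(** Sort by the number of larger values. *)
Lemma sort_distinct b : injective b ->
  exists p : 'S_l, strict_dec [ffun i => b (p i)].
Proof.
move=> b_inj; pose above i := [set j | (b i < b j)%N].
have above_lt i : (#|above i| < l)%N.
  rewrite -[ltnRHS]card_ord -cardsT proper_card //.
  by apply/properP; split; [apply: subsetT | exists i; rewrite !inE // ltnn].
have above_mono i k : (b i < b k)%N -> (#|above k| < #|above i|)%N.
  move=> lt_b; apply: proper_card; apply/properP; split.
    by apply/subsetP => j; rewrite !inE; apply: ltn_trans.
  by exists k; rewrite !inE // ltnn.
have f_inj : injective (fun i => Ordinal (above_lt i)).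
  move=> i k /(congr1 val) /= eq_card; apply: b_inj.
  by case: (ltngtP (b i) (b k)) => // /above_mono; rewrite eq_card ltnn.
pose q := perm f_inj; exists q^-1%g => i j; rewrite !ffunE.
have card_q k : #|above (q^-1%g k)| = k.
  by have := permKV q k; rewrite {1}permE => /(congr1 val).
move=> lt_ij;
  case: (ltngtP (b (q^-1%g i)) (b (q^-1%g j))) =>
    [/above_mono|//|/b_inj/perm_inj eq_ij].
  by rewrite !card_q => /(ltn_trans lt_ij); rewrite ltnn.
by rewrite eq_ij ltnn in lt_ij.
Qed.

Lemma strict_dec_beta b : strict_dec b ->
  exists2 la : {ffun 'I_l -> nat},
    forall i j : 'I_l, (i <= j)%N -> (la j <= la i)%N & b = beta la.
Proof.
move=> b_dec.
have gap k : forall i j : 'I_l, (j = i + k :> nat)%N -> (b j + k <= b i)%N.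
  elim: k => [|k IHk] i j; first by rewrite !addn0 => /val_inj->.
  rewrite addnS => def_j; have lt_l : (i + k < l)%N.
    by rewrite (leq_trans _ (ltn_ord j)) // def_j.
  apply: leq_trans (IHk i (Ordinal lt_l) erefl).
  by rewrite -addSnnS leq_add2r b_dec //= def_j.
have stairE i : stair l i = (l - i.+1)%N by rewrite ffunE.
have ge_stair i : (stair l i <= b i)%N.
  have l_gt0 : (l.-1 < l)%N by rewrite ltn_predL (leq_ltn_trans _ (ltn_ord i)).
  have := gap (l.-1 - i)%N i (Ordinal l_gt0); have := ltn_ord i.
  by rewrite stairE /=; lia.
exists [ffun i => b i - stair l i]%N => [i j le_ij|]; last first.
  by apply/ffunP => i; rewrite ffunE [in RHS]ffunE subnK.
rewrite [X in (X <= _)%N]ffunE [X in (_ <= X)%N]ffunE.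
have := gap (j - i)%N i j; have := ge_stair i; have := ge_stair j.
by have := ltn_ord j; rewrite !stairE; lia.
Qed.

End DecreasingVectors.

(** * Determinantal characters exhaust the irreducible characters *)

Section Completeness.

Variable n : nat.

(** A determinantal character vanishes or agrees up to sign with the one of the
  sorted vector, because the inner products show that the difference has norm
  0. *)
Lemma det_char_orth l (phi : 'CF([set: 'S_n])) :
  (forall c : {ffun 'I_l -> nat}, strict_dec c ->
     (\sum_i c i = n + 'C(l, 2))%N -> '[det_char n c, phi] = 0) ->
  forall b : {ffun 'I_l -> nat}, '[det_char n b, phi] = 0.
Proof.
move=> orth b.
have [sum_b|ne_b] := eqVneq (\sum_i b i)%N (n + 'C(l, 2))%N; last first.
  suff -> : det_char n b = 0 by rewrite cfdot0l.
  by apply/eqP; rewrite -cfnorm_eq0 cfdot_det_char (negPf ne_b) mul0r.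
case: (boolP (injectiveb b)) => [/injectiveP b_inj|/injectiveP b_ninj];
  last first.
  by rewrite det_char_ninj // cfdot0l.
have [p c_dec] := sort_distinct b_inj; set c := [ffun i => _] in c_dec.
have sum_c : (\sum_i c i = n + 'C(l, 2))%N.
  by rewrite -sum_b [RHS](reindex_inj (@perm_inj _ p)); apply: eq_bigr => i _;
    rewrite ffunE.
have def_b i : b i = c (p^-1%g i) by rewrite ffunE permKV.
suff -> : det_char n b = (-1) ^+ p *: det_char n c by rewrite cfdotZl orth
  ?mulr0.
apply/eqP;
  rewrite -subr_eq0 -cfnorm_eq0 cfnormB cfnorm_sign cfdotZr rmorph_sign.
rewrite !cfdot_det_char sum_b sum_c eqxx !mul1r.
rewrite (match_det_perm b_inj def_b) !match_det_same //;
  last exact: strict_dec_inj.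
by rewrite odd_permV -signr_addb addbb conjC1 subrr.
Qed.

(** Apart from the diagonal term, the determinant of a has terms of smaller row
  moment only, so induction on the row moment inverts it. *)
Lemma perm_char_orth l (phi : 'CF([set: 'S_n])) :
  (forall c : {ffun 'I_l -> nat}, strict_dec c ->
     (\sum_i c i = n + 'C(l, 2))%N -> '[det_char n c, phi] = 0) ->
  forall a : {ffun 'I_l -> nat}, '[perm_char n a, phi] = 0.
Proof.
move=> /det_char_orth orth a;
  move: {2}_.+1 (ltnSn (\sum_(i < l) i * a i)%N) => m.
elim: m a => // m IHm a; rewrite ltnS => le_m.
have := orth (beta a);
  rewrite cfdot_suml (bigD1 1%g) //= stair_sub1 odd_perm1 scale1r.
rewrite big1 ?addr0 // => s ne_s1; rewrite cfdotZl.
case def_a': stair_sub => [a'|] /=; last by rewrite cfdot0l mulr0.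
rewrite IHm ?mulr0 //; apply: leq_trans le_m.
have := row_moment_stair_sub def_a';
  have := contra_neq_not (@rearrangement _ s) ne_s1.
by move=> /negP; rewrite -ltnNge; lia.
Qed.

End Completeness.

(** * Labels by partitions *)

Definition parts l (la : seq nat) : {ffun 'I_l -> nat} :=
  [ffun i : 'I_l => nth 0%N la i].

Lemma sum_nth (F : nat -> nat) l (s : seq nat) :
  F 0%N = 0%N -> (size s <= l)%N ->
  (\sum_(i < l) F (nth 0 s i) = \sum_(x <- s) F x)%N.
Proof.
move=> F0; elim: s l => [|a s IHs] l.
  by rewrite big_nil big1 // => i; rewrite nth_nil.
by case: l => //= l; rewrite ltnS big_ord_recl big_cons => /IHs <-.
Qed.

Section Partitions.

Variables (n : nat) (la : seq nat).
Hypothesis hla : is_partition n la.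

Lemma partition_nth_dec i j : (i <= j)%N -> (nth 0 la j <= nth 0 la i)%N.
Proof.
move=> le_ij; have [le_sz|lt_j] := leqP (size la) j;
  first by rewrite nth_default.
have /and3P[sorted_la _ _] := hla.
apply: (sorted_leq_nth _ _ _ sorted_la) => //.
- by move=> a b c le_ba le_cb; apply: leq_trans le_ba.
- by move=> a; apply: leqnn.
- by rewrite inE (leq_ltn_trans le_ij).
Qed.

Lemma parts_dec l (i j : 'I_l) : (i <= j)%N -> (parts l la j <= parts l la i)%N.
Proof. by rewrite !ffunE; apply: partition_nth_dec. Qed.

Lemma sum_parts l : (size la <= l)%N -> (\sum_i parts l la i = n)%N.
Proof.
move=> le_l; have /and3P[_ _ /eqP <-] := hla.
rewrite sumnE -(sum_nth (F := id) _ le_l) //.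
by apply: eq_bigr => i _; rewrite ffunE.
Qed.

Lemma size_partition : (size la <= n)%N.
Proof.
have /and3P[_ + /eqP <-] := hla; elim: la => //= k s IHs.
rewrite inE negb_or eq_sym -lt0n => /andP[k_gt0 /IHs].
by rewrite -add1n; apply: leq_add.
Qed.

Lemma conj_partition_nth l j : (size la <= l)%N ->
  nth 0%N (conj_partition la) j = #|[set i : 'I_l | j < parts l la i]%N|.
Proof.
move=> le_l.
have -> : #|[set i : 'I_l | j < parts l la i]%N| = count (fun p => j < p)%N la.
  rewrite -sum1dep_card -sum1_count big_mkcond [RHS]big_mkcond /=.
  rewrite -(sum_nth (F := fun p => if (j < p)%N then 1%N else 0%N) _ le_l) //.
  by apply: eq_bigr => i _; rewrite ffunE.
have [lt_j|le_j] := ltnP j (head 0%N la).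
  by rewrite (nth_map 0%N) ?size_iota // nth_iota.
rewrite nth_default ?size_map ?size_iota //; apply/esym/eqP.
rewrite -leqn0 leqNgt -has_count; apply/hasPn => p /(nthP 0%N)[i _ <-].
rewrite -leqNgt; apply: leq_trans le_j; rewrite -nth0.
exact: partition_nth_dec.
Qed.

Lemma parts_conj_partition l : (size la <= l)%N ->
  parts n (conj_partition la) = conj_parts n (parts l la).
Proof.
by move=> le_l; apply/ffunP => j; rewrite !ffunE (conj_partition_nth _ le_l).
Qed.

Lemma size_conj_partition : (size (conj_partition la) <= n)%N.
Proof.
rewrite size_map size_iota -nth0.
by have /and3P[_ _ /eqP <-] := hla; case: (la) => //= a s; apply: leq_addr.
Qed.

Lemma sumn_conj_partition : sumn (conj_partition la) = n.
Proof.
rewrite sumnE -(sum_nth (F := id) _ size_conj_partition) //.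
rewrite -[RHS](sum_conj_parts (sum_parts (leqnn _))).
rewrite -parts_conj_partition //; apply: eq_bigr => i _; rewrite ffunE //.
Qed.

End Partitions.

Section YoungChar.

Variables (n m : nat) (s : seq nat).
Hypotheses (sum_s : sumn s = n) (le_sm : (size s <= m)%N).

Lemma reshape_index_cons a t x :
  reshape_index (a :: t) x = if (x < a)%N then 0%N else
    (reshape_index t (x - a)).+1.
Proof.
rewrite /reshape_index /= subn_eq0; case: ltnP => // le_ax.
by rewrite subSn.
Qed.

Lemma count_reshape_index t i :
  count (fun x => reshape_index t x == i) (iota 0 (sumn t)) = nth 0%N t i.
Proof.
elim: t i => [|a t IHt] i /=; first by rewrite nth_nil.
rewrite iotaD count_cat add0n.
have -> : count (fun x => reshape_index (a :: t) x == i) (iota 0 a)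
        = if i == 0%N then a else 0%N.
  rewrite (eq_in_count (a2 := fun=> i == 0%N)) => [|x].
    by case: (i == _); rewrite ?count_predT ?count_pred0 ?size_iota.
  by rewrite mem_iota /= => lt_xa; rewrite reshape_index_cons lt_xa eq_sym.
have -> : iota a (sumn t) = [seq (a + x)%N | x <- iota 0 (sumn t)].
  by rewrite -iotaDl addn0.
rewrite count_map (eq_count (a2 := fun x => (reshape_index t x).+1 == i));
  last first.
  by move=> x /=; rewrite reshape_index_cons ltnNge leq_addr /= addKn.
by case: i => [|i] /=; rewrite ?IHt // count_pred0 addn0.
Qed.

Let word_lt (x : 'I_n) : (reshape_index s x < m)%N.
Proof. by apply: leq_trans le_sm; apply: reshape_indexP; rewrite sum_s. Qed.

(** The word whose letter at a position is the row of that position when the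
  diagram is filled row by row; its stabiliser is the Young subgroup. *)
Definition young_word : {ffun 'I_n -> 'I_m} := [ffun x => Ordinal (word_lt x)].

Lemma content_young_word : content young_word = parts m s.
Proof.
apply/ffunP => i;
  rewrite content_codom ffunE -count_reshape_index codomE count_map.
rewrite sum_s -val_enum_ord count_map; apply: eq_count => x /=.
by rewrite ffunE -val_eqE.
Qed.

Lemma stab_young_word : stab young_word = young_group n s.
Proof.
apply: val_inj; apply/setP => g; rewrite !inE;
  apply/eqP/forallP => [/ffunP fix_g x|fix_g].
  by have := fix_g x; rewrite !ffunE => /(congr1 val) /= ->.
by apply/ffunP => x; rewrite !ffunE; apply: val_inj; apply/eqP/(fix_g x).
Qed.

Lemma cfInd_young : 'Ind[[set: 'S_n], young_group n s] 1 = perm_char n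
  (parts m s).
Proof. by rewrite -content_young_word perm_char_Ind stab_young_word. Qed.

End YoungChar.

Section Labels.

Variable n : nat.

Section OneLabel.

Variables (la : seq nat) (l : nat).
Hypotheses (hla : is_partition n la) (le_l : (size la <= l)%N).

Lemma Sn_irr_det : Sn_irr n la = det_char n (beta (parts l la)).
Proof.
have [i [def_i row_i col_i uniq_i]] :=
  det_char_irr (parts_dec hla (l := l)) (sum_parts hla le_l).
suff def_la : Sn_Iirr n la = i by rewrite /Sn_irr def_la.
have ind_row : 'Ind[[set: 'S_n], young_group n la] 1 = perm_char n (parts l la).
  by apply: cfInd_young => //; have /and3P[_ _ /eqP] := hla.
have ind_col : 'Ind[[set: 'S_n]]
      ('Res[young_group n (conj_partition la)] (sign_char n))
    = sign_char n * perm_char n (conj_parts n (parts l la)).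
  rewrite -(parts_conj_partition hla le_l).
  rewrite -(cfInd_young (sumn_conj_partition hla) (size_conj_partition hla)).
  by rewrite -[X in 'Ind X]mul1r cfIndM ?subsetT // mulrC.
rewrite /Sn_Iirr; case: pickP => [j|/(_ i)] /=.
  rewrite !irr_consttE ind_row ind_col.
  by move=> /andP[row_j col_j]; apply: uniq_i.
by rewrite !irr_consttE ind_row ind_col row_i col_i oner_eq0.
Qed.

End OneLabel.

Lemma parts_inj l la mu : is_partition n la -> is_partition n mu ->
  (size la <= l)%N -> (size mu <= l)%N -> parts l la = parts l mu -> la = mu.
Proof.
have aux la' mu' : is_partition n la' -> is_partition n mu' ->
  (size la' <= l)%N -> (size mu' <= l)%N -> parts l la' = parts l mu' ->
    (size mu' <= size la')%N.
  move=> _ /and3P[_ mu_n0 _] le_la le_mu /ffunP eq_parts; rewrite leqNgt;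
    apply/negP => lt_sz.
  have := eq_parts (Ordinal (leq_trans lt_sz le_mu));
    rewrite !ffunE /= nth_default // => mu0.
  by case/negP: mu_n0; rewrite mu0 mem_nth.
move=> hla hmu le_la le_mu eq_parts; apply: (@eq_from_nth _ 0%N) => [|i lt_i].
  by apply/eqP; rewrite eqn_leq !aux.
have := congr1
  (fun f : {ffun 'I_l -> nat} => f (Ordinal (leq_trans lt_i le_la))) eq_parts.
by rewrite !ffunE.
Qed.

Lemma Sn_Iirr_inj : {in partitions n &, injective (Sn_Iirr n)}.
Proof.
move=> la mu; rewrite !mem_partitions => hla hmu eq_i.
have := size_partition hla; have := size_partition hmu => le_mu le_la.
apply: (parts_inj hla hmu le_la le_mu).
have: '[Sn_irr n la, Sn_irr n mu] = 1 by rewrite /Sn_irr eq_i cfnorm_irr.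
have la_dec := beta_mono (parts_dec hla (l := n)).
have mu_dec := beta_mono (parts_dec hmu (l := n)).
rewrite (Sn_irr_det hla le_la) (Sn_irr_det hmu le_mu) cfdot_det_char
  match_det_dec //.
case: (beta _ =P beta _) => [/ffunP eq_b _|_ /eqP];
  last by rewrite mulr0 eq_sym oner_eq0.
by apply/ffunP => i; have := eq_b i; rewrite !betaE => /addIn.
Qed.

Lemma nth_filter_gt0 (s : seq nat) i : sorted geq s ->
  nth 0%N [seq x <- s | 0 < x]%N i = nth 0%N s i.
Proof.
elim: s i => //= x s IHs i s_sorted; have sorted_s := path_sorted s_sorted.
case: ltnP => [_|x0]; first by case: i => //= i; rewrite IHs.
have s0 k : nth 0%N s k = 0%N.
  have [le_k|lt_k] := leqP (size s) k; first by rewrite nth_default.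
  apply/eqP; rewrite -leqn0; apply: leq_trans x0.
  by have /allP := order_path_min
    (fun a b c le_ba le_cb => leq_trans le_cb le_ba) s_sorted; apply;
      apply: mem_nth.
by rewrite IHs // s0; case: i => [|i] /=; rewrite ?s0 //; apply/esym/eqP;
  rewrite -leqn0.
Qed.

Lemma partition_of_parts (a : {ffun 'I_n -> nat}) :
  (forall i j : 'I_n, (i <= j)%N -> (a j <= a i)%N) -> (\sum_i a i = n)%N ->
  exists2 la, is_partition n la & parts n la = a.
Proof.
move=> a_dec sum_a; pose s := [seq a i | i <- enum 'I_n].
have sorted_s : sorted geq s.
  rewrite sorted_map; have := iota_sorted 0 n; rewrite -val_enum_ord sorted_map.
  by apply: sub_sorted => i j; apply: a_dec.
have nth_s (i : 'I_n) : nth 0%N s i = a i.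
  by rewrite (nth_map i) ?size_enum_ord // nth_ord_enum.
exists [seq x <- s | 0 < x]%N; last first.
  by apply/ffunP => i; rewrite ffunE nth_filter_gt0.
apply/and3P; split; last 2 first.
- by rewrite mem_filter.
- rewrite sumnE big_filter big_mkcond -[X in _ == X]sum_a big_map big_enum /=.
  by apply/eqP/eq_bigr => i _; case: posnP.
by apply: sorted_filter => // x y z le_xy le_yz; apply: leq_trans le_xy.
Qed.

(** A character orthogonal to all [Sn_irr n la] is orthogonal to the
  permutation character on the words with distinct letters, which is the
  regular character. *)
Lemma Sn_Iirr_surj (i : Iirr [set: 'S_n]) : exists2 la, la \in partitions n &
  Sn_Iirr n la = i.
Proof.
have [/hasP[la la_n nz]|/hasPn orth] := boolP
  (has (fun la => '[Sn_irr n la, 'chi_i] != 0) (partitions n)).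
  by exists la => //; move: nz; rewrite cfdot_irr; case: (_ =P i);
    rewrite ?eqxx.
have orth_det (c : {ffun 'I_n -> nat}) : strict_dec c ->
    (\sum_i c i = n + 'C(n, 2))%N -> '[det_char n c, 'chi_i] = 0.
  move=> /strict_dec_beta[a a_dec ->] sum_b.
  have sum_a : (\sum_i a i = n)%N.
    move: sum_b; rewrite (eq_bigr (fun i => a i + stair n i)%N) => [|j _];
      last by rewrite betaE.
    by rewrite big_split /= sum_stair => /addIn.
  have [la hla def_a] := partition_of_parts a_dec sum_a.
  apply/eqP;
    rewrite -def_a -Sn_irr_det ?size_partition // -[_ == _]negbK orth //.
  by rewrite mem_partitions.
(* the identity word has a trivial stabiliser *)
pose w := [ffun x : 'I_n => x].
have := perm_char_orth orth_det (content w); rewrite cfdotC cfdot_perm_char.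
rewrite (big_pred1 1%g) => [/eqP|g].
  rewrite fmorph_eq0 mulf_eq0 invr_eq0 (negPf (neq0CG _)) /=.
  by rewrite (negPf (irr1_neq0 i)).
rewrite inE; apply/eqP/eqP => [/ffunP fix_g|->]; last exact: wact1.
by apply/permP => x; have := fix_g x; rewrite !ffunE perm1.
Qed.

Lemma sum_partitions (R : nmodType) (F : Iirr [set: 'S_n] -> R) :
  \sum_(la <- partitions n) F (Sn_Iirr n la) = \sum_i F i.
Proof.
rewrite -(big_map (Sn_Iirr n) predT F) -[RHS]big_enum /=; apply: perm_big.
apply: uniq_perm; rewrite ?enum_uniq ?map_inj_in_uniq ?partitions_uniq //.
  exact: Sn_Iirr_inj.
move=> i; rewrite mem_enum; apply/mapP.
by have [la la_n <-] := Sn_Iirr_surj i; exists la.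
Qed.

Lemma cfun_sum_partitions (phi : 'CF([set: 'S_n])) :
  phi = \sum_(mu <- partitions n) '[phi, Sn_irr n mu] *: Sn_irr n mu.
Proof.
rewrite (sum_partitions (fun i => '[phi, 'chi_i] *: 'chi_i)).
exact: cfun_sum_cfdot.
Qed.

End Labels.

(** * Restriction to smaller symmetric groups *)

Section Extend.

Variables (m : nat) (C : finType).
Implicit Types (c : C) (w : {ffun 'I_m -> C}) (a : 'S_m).

Definition extend c w : {ffun 'I_m.+1 -> C} :=
  [ffun x => if unlift ord_max x is Some y then w y else c].

Lemma extend_max c w : extend c w ord_max = c.
Proof. by rewrite ffunE unlift_none. Qed.

Lemma extend_lift c w x : extend c w (lift ord_max x) = w x.
Proof. by rewrite ffunE liftK. Qed.

Lemma extend_inj c c' w w' : extend c w = extend c' w' -> c = c' /\ w = w'.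
Proof.
move=> /ffunP eq_ext; split; first by have := eq_ext ord_max;
  rewrite !extend_max.
by apply/ffunP => x; have := eq_ext (lift ord_max x); rewrite !extend_lift.
Qed.

Lemma content_extend c w : content (extend c w) = raise (content w) c 1.
Proof.
apply/ffunP => d; rewrite [RHS]ffunE.
have -> : content (extend c w) d = ((c == d) + content w d)%N.
  rewrite [LHS]ffunE [content w d]ffunE -!sum1_card big_mkcond /= big_ord_recr
    /= addnC.
  congr (_ + _)%N; first by rewrite inE extend_max; case: eqP.
  rewrite [RHS]big_mkcond; apply: eq_bigr => x _; rewrite !inE.
  by rewrite (_ : widen_ord _ x = lift ord_max x) ?extend_lift //;
    apply/val_inj; rewrite /= /bump leqNgt ltn_ord.
by rewrite eq_sym; case: eqP => _; rewrite ?addn1 ?add0n ?add1n.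
Qed.

Lemma sum_extend (R : nmodType) (F : {ffun 'I_m.+1 -> C} -> R) :
  \sum_v F v = \sum_c \sum_w F (extend c w).
Proof.
rewrite pair_big (reindex (fun cw : C * {ffun 'I_m -> C} => extend cw.1 cw.2))
  //=.
exists (fun v : {ffun 'I_m.+1 -> C} =>
  (v ord_max, [ffun x => v (lift ord_max x)])) => [[c w] _|v _] /=.
  by rewrite extend_max; congr pair; apply/ffunP => x;
    rewrite ffunE extend_lift.
apply/ffunP => x; case: (unliftP ord_max x) => [y|] ->;
  first by rewrite extend_lift ffunE.
by rewrite extend_max.
Qed.

End Extend.

Section Up.

Variable m : nat.
Implicit Type a : 'S_m.

Definition up a : 'S_m.+1 := lift_perm ord_max ord_max a.

Lemma up_max a : up a ord_max = ord_max.
Proof. exact: lift_perm_id. Qed.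

Lemma up_lift a x : up a (lift ord_max x) = lift ord_max (a x).
Proof. exact: lift_perm_lift. Qed.

Lemma upM a a' : up (a * a') = (up a * up a')%g.
Proof. by rewrite /up lift_permM. Qed.

Lemma wact_up (C : finType) (c : C) w a : wact (extend c w) (up a) = extend c
  (wact w a).
Proof.
apply/ffunP => x; rewrite ffunE; case: (unliftP ord_max x) => [y|] ->.
  by rewrite up_lift !extend_lift ffunE.
by rewrite up_max !extend_max.
Qed.

Lemma up_inj : injective up.
Proof.
move=> a a' eq_up; apply/permP => x; apply: (@lift_inj _ ord_max).
by rewrite -!up_lift eq_up.
Qed.

Lemma fix_max_up (g : 'S_m.+1) : g ord_max = ord_max -> exists a, g = up a.
Proof.
move=> fix_g.
have lift_g (x : 'I_m) : {y | g (lift ord_max x) = lift ord_max y}.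
  case: (unliftP ord_max (g (lift ord_max x))) => [y ->|]; first by exists y.
  rewrite -{2}fix_g => /perm_inj/eqP; rewrite eq_sym.
  by rewrite (negPf (neq_lift _ _)).
have inj : injective (fun x => sval (lift_g x)).
  move=> x y /= eq_xy; apply: (@lift_inj _ ord_max); apply: (@perm_inj _ g).
  by apply: etrans (svalP (lift_g x)) _; rewrite eq_xy -(svalP (lift_g y)).
exists (perm inj); apply/permP => x; case: (unliftP ord_max x) => [y|] ->.
  by rewrite up_lift permE; apply: (svalP (lift_g y)).
by rewrite up_max.
Qed.

Lemma sum_fix_max (R : nmodType) (P : pred 'S_m.+1) (F : 'S_m.+1 -> R) :
  \sum_(g | P g && (g ord_max == ord_max)) F g = \sum_(a | P (up a)) F (up a).
Proof.
have : {on [pred g : 'S_m.+1 | P g && (g ord_max == ord_max)], bijective up}.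
  apply: subon_bij (bij_on_codom up_inj 1%g).
  by move=> g /andP[_ /eqP/fix_max_up[a ->]]; apply: codom_f.
move=> up_bij; rewrite (reindex up) //=.
by apply: eq_bigl => a; rewrite up_max eqxx andbT.
Qed.

End Up.

Section StabExtend.

Variables (m : nat) (C : finType).

(** The last position is the only one with the letter c, so the stabiliser
  fixes it. *)
Lemma sum_stab_extend (R : nmodType) c (w : {ffun 'I_m -> C})
  (F : 'S_m.+1 -> R) :
  (forall x, w x != c) ->
  \sum_(g in stab (extend c w)) F g = \sum_(a in stab w) F (up a).
Proof.
move=> w_ne_c;
  rewrite (eq_bigl
    (fun g => (g \in stab (extend c w)) && (g ord_max == ord_max))).
  rewrite sum_fix_max; apply: eq_bigl => a; rewrite !inE wact_up.
  by apply/eqP/eqP => [/extend_inj[]|->].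
move=> g; apply/esym/andb_idr; rewrite inE => /eqP/ffunP/(_ ord_max).
rewrite extend_max ffunE; case: (unliftP ord_max (g ord_max)) => [y|] -> //.
by rewrite extend_lift => eq_c; have := w_ne_c y; rewrite eq_c eqxx.
Qed.

Definition last2 : 'S_m.+2 := tperm ord_max (lift ord_max ord_max).

Lemma wact_last2 c d (w : {ffun 'I_m -> C}) :
  wact (extend c (extend d w)) last2 = extend d (extend c w).
Proof.
have ne_max : lift ord_max ord_max != ord_max :> 'I_m.+2 by rewrite eq_sym
  neq_lift.
apply/ffunP => x; rewrite ffunE /last2; case: tpermP => [->|->|].
- by rewrite extend_lift !extend_max.
- by rewrite extend_max extend_lift extend_max.
case: (unliftP ord_max x) => [y|] -> // _.
case: (unliftP ord_max y) => [z|] -> // _.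
by rewrite !extend_lift.
Qed.

(** Exactly the last two positions carry the letter c, so the stabiliser fixes
  or exchanges them. *)
Lemma sum_stab_extend2 (R : nmodType) c (w : {ffun 'I_m -> C})
  (F : 'S_m.+2 -> R) :
  (forall x, w x != c) ->
  \sum_(g in stab (extend c (extend c w))) F g
  = \sum_(a in stab w) (F (up (up a)) + F (up (up a) * last2)%g).
Proof.
move=> w_ne_c; rewrite (bigID (fun g : 'S_m.+2 => g ord_max == ord_max)) /=.
have sum_fix (F' : 'S_m.+2 -> R) :
    \sum_(g | (g \in stab (extend c (extend c w))) && (g ord_max == ord_max))
      F' g
    = \sum_(a in stab w) F' (up (up a)).
  rewrite sum_fix_max -(sum_stab_extend (fun a => F' (up a)) w_ne_c).
  apply: eq_bigl => a; rewrite !inE wact_up.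
  by apply/eqP/eqP => [/extend_inj[]|->].
rewrite big_split /= sum_fix; congr (_ + _).
rewrite -(sum_fix (fun g => F (g * last2)%g)).
rewrite (reindex_inj (mulIg last2)) /=; apply: eq_bigl => g.
rewrite !inE wactM wact_last2; case: eqP => // /ffunP/(_ ord_max).
rewrite extend_max ffunE permM /last2.
case: (unliftP ord_max (g ord_max)) => [y|] ->; last first.
  by rewrite tpermL eqxx eq_sym neq_lift.
rewrite extend_lift; case: (unliftP ord_max y) => [z|] ->.
  by rewrite extend_lift => eq_c; have := w_ne_c z; rewrite eq_c eqxx.
by rewrite tpermR eqxx /= eq_sym (negPf (neq_lift _ _)).
Qed.

Lemma stab_const (c : C) : stab [ffun _ : 'I_m => c] = [set: 'S_m] :>
  {set 'S_m}.
Proof. by apply/setP => g; rewrite !inE; apply/eqP/ffunP => x;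
  rewrite !ffunE. Qed.

End StabExtend.

Section Branching.

Variable l : nat.
Implicit Type b : {ffun 'I_l -> nat}.

(** The branching rule: the fixed point of the permutation carries a letter i,
  and deleting it lowers the content at i by 1. *)
Lemma det_char_up m b (a : 'S_m) :
  det_char m.+1 b (up a) = \sum_(i | (0 < b i)%N) det_char m (lower b i 1) a.
Proof.
rewrite det_charE big_mkcond sum_extend [RHS]big_mkcond; apply: eq_bigr => i _.
rewrite (eq_bigr (fun w => if wact w a == w
   then (0 < b i)%N%:R * stair_det (content w) (lower b i 1) else 0)) => [|w _].
  rewrite -big_mkcond /= -mulr_sumr -det_charE.
  by case: ifP; rewrite ?mul1r ?mul0r.
rewrite wact_up content_extend stair_det_raise.
by congr (if _ then _ else _); apply/eqP/eqP => [/extend_inj[]|->].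
Qed.

(** The Murnaghan-Nakayama rule for a 2-cycle: its two points carry the same
  letter i, and deleting them lowers the content at i by 2. *)
Lemma det_char_up_last2 m b (a : 'S_m) :
  det_char m.+2 b (up (up a) * last2 m)%g = \sum_(i | (1 < b i)%N) det_char m
    (lower b i 2) a.
Proof.
rewrite det_charE big_mkcond sum_extend [RHS]big_mkcond; apply: eq_bigr => i _.
rewrite sum_extend (bigD1 i) //= addrC big1 ?add0r => [|j ne_ji]; last first.
  rewrite big1 // => w _; rewrite wactM wact_last2 !wact_up.
  by case: eqP => // /extend_inj[eq_ji]; rewrite eq_ji eqxx in ne_ji.
rewrite (eq_bigr (fun w => if wact w a == w
   then (1 < b i)%N%:R * stair_det (content w) (lower b i 2) else 0)) => [|w _].
  rewrite -big_mkcond /= -mulr_sumr -det_charE.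
  by case: ifP; rewrite ?mul1r ?mul0r.
rewrite wactM wact_last2 !wact_up !content_extend.
have -> : raise (raise (content w) i 1) i 1 = raise (content w) i 2.
  by apply/ffunP => j; rewrite !ffunE; case: eqP => // _; rewrite -addnA.
rewrite stair_det_raise; congr (if _ then _ else _).
by apply/eqP/eqP => [/extend_inj[_ /extend_inj[]]|->].
Qed.

End Branching.

(** * Hooks as bead moves *)

(** With beads at the positions b of an abacus, bead i can move down by k steps
  to a free position. *)
Definition movable l k (b : {ffun 'I_l -> nat}) (i : 'I_l) : bool :=
  (k <= b i)%N && [forall j, b j != (b i - k)%N].

Section Hooks.

Variables (n : nat) (la : seq nat).
Hypothesis hla : is_partition n la.

Let l := size la.
Let p : {ffun 'I_l -> nat} := parts l la.
Let b : {ffun 'I_l -> nat} := beta p.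

Let p_dec (i j : 'I_l) : (i <= j)%N -> (p j <= p i)%N.
Proof. exact: (parts_dec hla). Qed.

Let pE (i : 'I_l) : p i = nth 0%N la i. Proof. by rewrite ffunE. Qed.

Lemma big_boxes (F : nat * nat -> nat) :
  (\sum_(c <- boxes la) F c = \sum_(i < l) \sum_(j < p i) F
    (nat_of_ord i, nat_of_ord j))%N.
Proof.
have iotaE k : iota 0 k = index_iota 0 k by rewrite /index_iota subn0.
rewrite /boxes big_allpairs_dep iotaE big_mkord.
by apply: eq_bigr => i _; rewrite -pE iotaE big_mkord.
Qed.

Lemma size_hook (i : 'I_l) j : (j < p i)%N ->
  size (hook la (nat_of_ord i, j)) =
    (p i - j + #|[set i' : 'I_l | (i < i') && (j < p i')]|)%N.
Proof.
move=> lt_j;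
  rewrite /hook size_filter -sum1_count big_mkcond big_boxes (bigD1 i) //=.
congr (_ + _)%N.
  rewrite (eq_bigr (fun x : 'I_(p i) => 1 - (x < j))%N) => [|x _]; last first.
    by rewrite eqxx leqnn andbT /=; case: ltngtP; rewrite ?orbT ?orbF.
  rewrite sumnB => [|x _]; last by case: ltnP.
  by rewrite sum_ltn ?(ltnW lt_j) // sum_nat_const card_ord muln1.
rewrite -sum1dep_card [RHS]big_mkcond [RHS](bigD1 i) //= ltnn add0n.
apply: eq_bigr => i' ne_i; rewrite val_eqE (negPf ne_i) /= leq_eqVlt.
rewrite [i == i' :> nat]eq_sym val_eqE (negPf ne_i) /=.
case: (ltnP i i') => _; last by rewrite big1 // => x _; rewrite andbF.
have [lt_j'|le_j'] := ltnP j (p i'); last first.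
  by rewrite big1 // => x _; rewrite andbT; case: eqP => // eq_x;
    have := ltn_ord x; rewrite eq_x ltnNge le_j'.
rewrite (bigD1 (Ordinal lt_j')) //= eqxx big1 // => x ne_x.
by rewrite andbT; case: eqP => // eq_x; case/eqP: ne_x; apply: val_inj.
Qed.

Section Row.

Variable i : 'I_l.

(** The free positions below bead i correspond to the boxes in row i: [gap j]
  is the position for column j, and the hook length is its distance from bead
  i. *)
Let gap j := (j + #|[set i' : 'I_l | (i < i') && (p i' <= j)]|)%N.

Let card_above (i' : 'I_l) : #|[set k : 'I_l | i' < k]%N| = (l - i'.+1)%N.
Proof.
have := cardsC [set k : 'I_l | k < i'.+1]%N;
  rewrite card_initial // card_ord => def_l.
have -> : (l - i'.+1 = #|~: [set k : 'I_l | k < i'.+1]|)%N by rewrite -{1}def_l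
  addKn.
by apply: eq_card => k; rewrite !inE ltnS -ltnNge.
Qed.

Lemma gap_hook j : (j < p i)%N ->
  (size (hook la (nat_of_ord i, j)) + gap j = b i)%N.
Proof.
move=> lt_j; rewrite size_hook // /gap betaE [stair _ _]ffunE /= -card_above.
rewrite -(cardsID [set k | p k <= j]%N [set k : 'I_l | i < k]%N) addnACA subnK
  ?(ltnW lt_j) //.
rewrite [(#|_ :&: _| + _)%N]addnC; congr (_ + (_ + _))%N.
  by apply: eq_card => k; rewrite !inE -ltnNge andbC.
by apply: eq_card => k; rewrite !inE.
Qed.

(** If row i' is longer than j then [gap j] lies below bead i', otherwise above
  it. *)
Lemma gap_neq_b j i' : (j < p i)%N -> gap j != b i'.
Proof.
move=> lt_j; have [le_i|lt_i] := leqP i' i.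
  have := gap_hook lt_j; rewrite size_hook // => def_b.
  have le_b : (b i <= b i')%N.
    case: (ltngtP i' i) le_i => // [lt_i _|/val_inj-> //].
    by apply: ltnW; apply: beta_mono.
  by move: lt_j def_b le_b; lia.
have b_i' : b i' = (p i' + (l - i'.+1))%N by rewrite betaE [stair _ _]ffunE.
have [le_pj|lt_jp] := leqP (p i') j.
  have : (l - i' <= #|[set k : 'I_l | (i < k) && (p k <= j)]|)%N.
    rewrite -[(l - i')%N](_ : #|[set k : 'I_l | i'.-1 < k]%N| = _); last first.
      have lt_l : (i'.-1 < l)%N by rewrite (leq_ltn_trans (leq_pred _)).
      by rewrite (card_above (Ordinal lt_l)) /= prednK
        // (leq_ltn_trans _ lt_i).
    rewrite subset_leq_card //; apply/subsetP => k; rewrite !inE => lt_k.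
    have le_k : (i' <= k)%N by move: lt_k lt_i; lia.
    by rewrite (leq_trans lt_i) // (leq_trans (p_dec le_k)).
  by rewrite b_i' /gap; have := ltn_ord i'; move: le_pj; lia.
have : (#|[set k : 'I_l | (i < k) && (p k <= j)]| <= l - i'.+1)%N.
  rewrite -card_above subset_leq_card //; apply/subsetP => k; rewrite !inE.
  move=> /andP[_ le_pk]; rewrite ltnNge; apply: contraL le_pk => /p_dec le_p.
  by rewrite -ltnNge (leq_trans lt_jp).
by rewrite b_i' /gap; move: lt_jp; lia.
Qed.

Lemma gap_mono j j' : (j < j')%N -> (gap j < gap j')%N.
Proof.
move=> lt_j; rewrite /gap -addSn leq_add // subset_leq_card //.
apply/subsetP => k; rewrite !inE => /andP[-> le_j] /=.
exact: leq_trans le_j (ltnW lt_j).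
Qed.

(** There are [b i] positions below bead i, of which l - i.+1 are taken by the
  beads after i and [p i] are of the form [gap j]; so there are no others. *)
Lemma gap_surj v : (v < b i)%N -> (forall j, b j != v) -> exists j : 'I_(p i),
  gap j = v.
Proof.
move=> lt_v v_free.
have gap_lt (j : 'I_(p i)) : (gap j < b i)%N.
  have := gap_hook (ltn_ord j); rewrite size_hook ?ltn_ord // => <-.
  by have := ltn_ord j; lia.
pose A := [set Ordinal (gap_lt j) | j : 'I_(p i)].
have cardA : #|A| = p i.
  rewrite card_imset ?card_ord // => j j' [eq_gap]; apply: val_inj.
  by case: (ltngtP j j') => // /gap_mono; rewrite eq_gap ltnn.
pose q (i' : 'I_l) := insubd (Ordinal lt_v) (b i').
have qE (i' : 'I_l) : (i < i')%N -> val (q i') = b i'.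
  by move=> lt_i; rewrite val_insubd beta_mono.
pose B := [set q i' | i' in [set k : 'I_l | i < k]%N].
have cardB : #|B| = (l - i.+1)%N.
  rewrite card_in_imset ?card_above // => k k'; rewrite !inE => lt_k lt_k' eq_q.
  by apply: (beta_inj p_dec); rewrite -(qE _ lt_k) -(qE _ lt_k') eq_q.
have disjAB : A :&: B = set0.
  apply/setP => x; rewrite !inE; apply/andP => [[/imsetP[j _ ->] /imsetP[k]]].
  rewrite inE => lt_k /(congr1 val); rewrite qE //= => /eqP.
  by rewrite (negPf (gap_neq_b k (ltn_ord j))).
have fullAB : A :|: B = [set: 'I_(b i)].
  apply/eqP;
    rewrite eqEcard subsetT cardsU disjAB cards0 subn0 cardA cardB cardsT
      card_ord.
  by rewrite betaE [stair _ _]ffunE /= leqnn.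
have : Ordinal lt_v \in A :|: B by rewrite fullAB inE.
rewrite inE => /orP[] /imsetP[j].
  by move=> _ /(congr1 val) /= ->; exists j.
by rewrite inE => lt_j /(congr1 val); rewrite qE //= => eq_v; have := v_free j;
  rewrite eq_v eqxx.
Qed.

Lemma count_row_hooks k : (0 < k)%N ->
  (\sum_(j < p i) (size (hook la (nat_of_ord i, nat_of_ord j)) == k)
    = movable k b i)%N.
Proof.
move=> k_gt0; rewrite /movable; case: (leqP k (b i)) => [le_kb|lt_bk] /=;
  last first.
  rewrite big1 // => j _; case: eqP => // def_k; have := gap_hook (ltn_ord j).
  by rewrite def_k => def_b; move: lt_bk; rewrite -def_b ltnNge leq_addr.
case: forallP => [v_free|no_free].
  have lt_v : (b i - k < b i)%N by rewrite ltn_subrL k_gt0 (leq_trans k_gt0).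
  have [j def_v] := gap_surj lt_v v_free.
  have hook_j : size (hook la (nat_of_ord i, nat_of_ord j)) = k.
    by have := gap_hook (ltn_ord j); rewrite def_v; lia.
  rewrite (bigD1 j) //= hook_j eqxx big1 // => j' ne_j.
  case: eqP => // hook_j'; have := gap_hook (ltn_ord j');
    rewrite hook_j' => gap_j'.
  have eq_gap : gap j' = gap j by rewrite def_v; lia.
  case/eqP: ne_j; apply: val_inj.
  by case: (ltngtP j' j) => // /gap_mono; rewrite eq_gap ltnn.
rewrite big1 // => j _; case: eqP => // hook_j; case: no_free => i'.
have := gap_hook (ltn_ord j); rewrite hook_j => def_b.
by rewrite -def_b addKn eq_sym gap_neq_b.
Qed.

End Row.

Lemma nhooks_movable k : (0 < k)%N -> nhooks k la = #|[set i | movable k b i]|.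
Proof.
move=> k_gt0;
  rewrite /nhooks -sum1_count big_mkcond big_boxes -sum1dep_card
    [RHS]big_mkcond.
apply: eq_bigr => i _;
  rewrite -[RHS]/(nat_of_bool _) -(count_row_hooks i k_gt0).
by apply: eq_bigr => j _.
Qed.

End Hooks.

(** * Moves on decreasing beta-numbers *)

Section RealSums.

Variables (m l : nat).
Implicit Types b c : {ffun 'I_l -> nat}.

Lemma sum_det_charM b c :
  \sum_a det_char m b a * det_char m c a
  = m`!%:R * (((\sum_i b i)%N == (m + 'C(l, 2))%N)%:R * match_det b c).
Proof.
rewrite -cfdot_det_char cfdotE cardsT card_Sn mulVKf ?pnatr_eq0 -?lt0n
  ?fact_gt0 //.
by apply: eq_big => [a|a _]; rewrite ?inE // (conj_Creal (det_char_real _ _)).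
Qed.

(** The irreducible character [det_char c] has multiplicity one in the
  permutation character of content la. *)
Lemma det_char_indicator c : strict_dec c -> (\sum_i c i = m + 'C(l, 2))%N ->
  \sum_(a : 'S_m) det_char m c (a ^+ 2)%g = m`!%:R.
Proof.
move=> /strict_dec_beta[la la_dec ->] sum_b.
have sum_la : (\sum_i la i = m)%N.
  move: sum_b; rewrite (eq_bigr (fun i => la i + stair l i)%N) => [|j _];
    last by rewrite betaE.
  by rewrite big_split /= sum_stair => /addIn.
have [i [def_i row_i _ _]] := det_char_irr la_dec sum_la.
have [w def_la] := exists_content sum_la.
have := indicator_mult1 (H := stab w) (i := i) (subsetT _).
rewrite def_i cardsT card_Sn (eq_bigl predT) => [->//|g]; last by rewrite inE.
  by move=> g; rewrite -def_i det_char_real.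
by rewrite cfdot_Res_l -perm_char_Ind def_la cfdotC row_i conjC1.
Qed.

End RealSums.

Section Moves.

Variable l : nat.
Implicit Types (b : {ffun 'I_l -> nat}) (i j : 'I_l).

Lemma movableP k b i : reflect ((k <= b i)%N /\ forall j, b j <> (b i - k)%N)
  (movable k b i).
Proof.
apply: (iffP andP) => [[le_k /forallP free]|[le_k free]]; split=> //.
  by move=> j; apply/eqP.
by apply/forallP => j; apply/eqP.
Qed.

Lemma lowerE b i k j : lower b i k j = (if j == i then b j - k else b j)%N.
Proof. by rewrite ffunE. Qed.

Lemma lower_inj b i k : injective b -> movable k b i -> injective (lower b i k).
Proof.
move=> b_inj /movableP[_ free] j j'; rewrite !lowerE.
have [->|_] := eqVneq j i; have [->|_] := eqVneq j' i => //.
- by move=> eq_b; case: (free j').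
- by move=> eq_b; case: (free j).
- exact: b_inj.
Qed.

Lemma lower_ninj b i k : (0 < k <= b i)%N -> ~~ movable k b i -> ~ injective
  (lower b i k).
Proof.
move=> /andP[k_gt0 le_k]; rewrite /movable le_k /= => /forallPn[j];
  rewrite negbK => /eqP eq_b low_inj.
have ne_ji : j != i.
  by apply: contraTneq le_k => eq_ji; move: eq_b; rewrite eq_ji -ltnNge; lia.
by apply/(negP ne_ji)/eqP/low_inj; rewrite !lowerE eqxx (negPf ne_ji).
Qed.

Lemma lower_dec b i : strict_dec b -> movable 1 b i -> strict_dec (lower b i 1).
Proof.
move=> b_dec /movableP[b_gt0 free] j j' lt_jj'; have lt_b := b_dec _ _ lt_jj'.
rewrite !lowerE; have [eq_j'|ne_j'] := eqVneq j' i;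
  have [eq_j|ne_j] := eqVneq j i.
- by rewrite eq_j eq_j' ltnn in lt_jj'.
- by apply: leq_ltn_trans lt_b; apply: leq_subr.
- by rewrite eq_j in lt_b *; have := free j'; lia.
- exact: lt_b.
Qed.

Lemma det_char_up_movable m b (a : 'S_m) : strict_dec b ->
  det_char m.+1 b (up a) = \sum_(i | movable 1 b i) det_char m (lower b i 1) a.
Proof.
move=> b_dec;
  rewrite det_char_up (bigID (movable 1 b)) /= addrC big1 ?add0r => [|i].
  by apply: eq_bigl => i; rewrite andb_idl // => /andP[].
by move=> /andP[b_gt0 imm]; rewrite det_char_ninj ?cfunE //; apply: lower_ninj.
Qed.

Lemma det_char_up_last2_movable m b (a : 'S_m) : strict_dec b ->
  det_char m.+2 b (up (up a) * last2 m)%g = \sum_(i | movable 2 b i) det_char m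
    (lower b i 2) a.
Proof.
move=> b_dec;
  rewrite det_char_up_last2 (bigID (movable 2 b)) /= addrC big1 ?add0r => [|i].
  by apply: eq_bigl => i; rewrite andb_idl // => /andP[].
by move=> /andP[b_gt0 imm]; rewrite det_char_ninj ?cfunE //; apply: lower_ninj.
Qed.

Variable b : {ffun 'I_l -> nat}.
Hypothesis b_dec : strict_dec b.

Let b_inj : injective b. Proof. exact: strict_dec_inj. Qed.

Let r1 := #|[set i | movable 1 b i]|.
Let r2 := #|[set i | movable 2 b i]|.

Definition two_moves i j := movable 1 b i && movable 1 (lower b i 1) j.

(** After the move of bead i, bead j can move if it could before, or if bead i
  has been the obstacle. *)
Lemma two_moves_neq i j : i != j ->
  (two_moves i j = (movable 1 b i && movable 1 b j)
                   + (movable 1 b i && (b j == (b i).+1)) :> nat)%N.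
Proof.
move=> ne_ij; rewrite /two_moves;
  case: (boolP (movable 1 b i)) => //= /movableP[bi_gt0 free_i].
have low_j : lower b i 1 j = b j by rewrite lowerE eq_sym (negPf ne_ij).
have ne_b : b i <> b j by move/b_inj/eqP; apply/negP.
have [eq_bj|ne_bj] := eqVneq (b j) (b i).+1.
  have -> : movable 1 b j = false.
    by apply/movableP => [[_ /(_ i)]]; rewrite eq_bj subn1.
  suff -> : movable 1 (lower b i 1) j by [].
  apply/movableP; rewrite low_j eq_bj; split=> // k; rewrite lowerE.
  have [->|ne_k] := eqVneq k i; first by lia.
  by rewrite subn1 /= => /b_inj/eqP; rewrite (negPf ne_k).
rewrite addn0; congr (nat_of_bool _); apply/movableP/movableP; rewrite low_j.
  move=> [bj_gt0 free]; split=> // k eq_k; have := free k; rewrite lowerE.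
  by case: eqP eq_k => [->|_] eq_k; [move/eqP: ne_bj; lia | ].
move=> [bj_gt0 free]; split=> // k; rewrite lowerE; case: eqP => [->|_].
  by lia.
exact: free.
Qed.

Lemma two_moves_same i : two_moves i i = movable 2 b i &&
  [forall j, b j != (b i).-1].
Proof.
apply/andP/andP =>
  [[/movableP[bi_gt0 free] /movableP[]]|[/movableP[bi_gt1 free2] /forallP
    free1]].
  rewrite !lowerE eqxx => bi_gt1 free2; split; last first.
    by apply/forallP => j; apply/eqP; rewrite -subn1; apply: free.
  apply/movableP; split=> [|j]; first by lia.
  have := free2 j; rewrite lowerE; have [->|_] := eqVneq j i; first by lia.
  by rewrite -subnDA.
split; apply/movableP; first by split=> [|j]; [lia | rewrite subn1; apply/eqP].
rewrite !lowerE eqxx; split=> [|j]; first by lia.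
rewrite lowerE; have [->|_] := eqVneq j i; first by lia.
by rewrite -subnDA.
Qed.

Let sum_pairs : (\sum_i \sum_(j | j != i) (movable 1 b i && movable 1 b j) = r1
  * r1.-1)%N.
Proof.
rewrite (eq_bigr (fun i => if movable 1 b i then r1.-1 else 0%N)) => [|i _].
  by rewrite -big_mkcond /= sum_nat_cond_const.
case: ifP => mi /=; last by rewrite big1.
rewrite -big_mkcondr /= sum1dep_card /r1 [in RHS](cardsD1 i) inE mi /=.
by apply: eq_card => j; rewrite !inE.
Qed.

(** Two distinct movable beads can move in either order. The remaining pairs
  correspond to the hooks of length 2 of one bead j: a horizontal domino moves
  bead j twice; a vertical one moves the bead directly below j, and then j. *)
Lemma card_two_moves : (\sum_i \sum_j two_moves i j = r2 + r1 * r1.-1)%N.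
Proof.
transitivity (\sum_i (two_moves i i + \sum_(j | j != i)
    ((movable 1 b i && movable 1 b j) +
      (movable 1 b i && (b j == (b i).+1)))))%N.
  apply: eq_bigr => i _; rewrite (bigD1 i) //=; congr (_ + _)%N.
  by apply: eq_bigr => j ne_j; rewrite two_moves_neq // eq_sym.
rewrite big_split /=
  [X in (_ + X)%N](eq_bigr
    (fun i => \sum_(j | j != i) (movable 1 b i && movable 1 b j)
   + \sum_(j | j != i) (movable 1 b i && (b j == (b i).+1))))%N; last first.
  by move=> i _; rewrite big_split.
rewrite big_split /= sum_pairs addnCA addnC; congr (_ + _)%N.
rewrite (exchange_big_dep predT) //= -big_split /= /r2 -sum1dep_card
  [RHS]big_mkcond.
apply: eq_bigr => j _ /=; rewrite two_moves_same.
(* bead j moves twice if the position directly below it is free; otherwise its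
  obstacle k has to move first *)
case: (boolP [forall k, b k != (b j).-1]) => [/forallP free|/forallPn[k]].
  rewrite andbT big1 ?addn0; first by case: ifP.
  by move=> i _; case: eqP => [eq_b|]; rewrite ?andbF //; have := free i;
    rewrite eq_b eqxx.
rewrite negbK andbF add0n => /eqP eq_bk.
have [bj0|bj_gt0] := posnP (b j).
  rewrite big1 => [|i _]; last by rewrite bj0 andbF.
  by case: ifP => // /movableP[]; rewrite bj0.
have ne_kj : j != k by apply: contraTneq bj_gt0 => eq_jk; move: eq_bk;
  rewrite eq_jk -leqNgt; lia.
rewrite (bigD1 k) //= big1 ?addn0 => [|i /andP[_ ne_ik]]; last first.
  case: (b j =P _); rewrite ?andbF // => eq_bj.
  by case/eqP: ne_ik; apply: b_inj; rewrite eq_bk eq_bj.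
rewrite (_ : (b j == _)); last by rewrite eq_bk prednK.
rewrite andbT -[RHS]/(nat_of_bool (movable 2 b j)); congr nat_of_bool.
apply/movableP/movableP; rewrite eq_bk => -[gt0 free]; split; try lia.
  by move=> i; have := free i; lia.
by move=> i; have := free i; lia.
Qed.

Lemma lower2_eq i j i' j' : two_moves i j -> two_moves i' j' ->
  (lower (lower b i 1) j 1 == lower (lower b i' 1) j' 1)
  = ((i' == i) && (j' == j)) || ((i' == j) && (j' == i)).
Proof.
move=> /andP[/movableP[gi _] /movableP[gj _]]
  /andP[/movableP[gi' _] /movableP[gj' _]].
have lowE (x y k : 'I_l) : (0 < b x)%N -> (0 < lower b x 1 y)%N ->
   (lower (lower b x 1) y 1 k + ((k == x) + (k == y)) = b k)%N.
  move=> gx; rewrite !lowerE; have [->|_] := eqVneq k y;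
    have [//|_] := eqVneq y x => gy;
    have [?|?] := eqVneq k x; subst => //=; lia.
apply/eqP/orP => [eq_low|].
  have eqk k : ((k == i) + (k == j) = (k == i') + (k == j'))%N.
    by have := lowE i j k gi gj;
      rewrite eq_low -(lowE i' j' k gi' gj') => /addnI.
  have := eqk i; have := eqk j;
    rewrite !eqxx [j == i]eq_sym [j == i']eq_sym [j == j']eq_sym
      [i == i']eq_sym [i == j']eq_sym.
  have := eqk i'; have := eqk j'; rewrite !eqxx [j' == i']eq_sym.
  by move: (i == j) (i' == i) (j' == j) (i' == j) (j' == i) (i' == j') => [] []
    [] [] [] [] //=; lia.
move=> eq_ij; apply/ffunP => k; apply/eqP.
rewrite -(eqn_add2r ((k == i) + (k == j))) lowE //.
have -> : ((k == i) + (k == j) = (k == i') + (k == j'))%N.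
  by case: eq_ij => /andP[/eqP-> /eqP->] //; rewrite addnC.
by rewrite lowE.
Qed.

(** Pairs that can be exchanged contribute twice as often as the others. *)
Lemma sum_two_moves_eq :
  (\sum_i \sum_j \sum_i' \sum_j' [&& two_moves i j, two_moves i' j' &
      lower (lower b i 1) j 1 == lower (lower b i' 1) j' 1] = r2 + 2 *
        (r1 * r1.-1))%N.
Proof.
transitivity
  (\sum_i \sum_j
    (two_moves i j + (if j != i then movable 1 b i && movable 1 b j else
      false)))%N.
  apply: eq_bigr => i _; apply: eq_bigr => j _.
  case: (boolP (two_moves i j)) => [tij|ntij] /=; last first.
    rewrite big1 => [|i' _]; last by rewrite big1.
    case: ifP => //; rewrite eq_sym => /two_moves_neq; rewrite (negPf ntij).
    by case: (_ && _).
  rewrite pair_big /= (bigD1 (i, j)) //= tij lower2_eq // !eqxx /=;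
    congr (_ + _)%N.
  have [eq_ji|ne_ji] := eqVneq j i.
    subst j; rewrite big1 // => -[i' j'] /= ne;
      case: (boolP (two_moves i' j')) => //= tij'.
    by rewrite lower2_eq //; move: ne; rewrite xpair_eqE orbb => /negPf->.
  rewrite (bigD1 (j, i)) /=; last by rewrite xpair_eqE negb_and ne_ji.
  rewrite big1 ?addn0 => [|[i' j'] /= /andP[ne1 ne2]]; last first.
    case: (boolP (two_moves i' j')) => //= tij'; rewrite lower2_eq //.
    by move: ne1 ne2; rewrite !xpair_eqE => /negPf-> /negPf->.
  case: (boolP (two_moves j i)) => /= [tji|ntji].
    rewrite lower2_eq // !eqxx orbT.
    by move: tij tji => /andP[-> _] /andP[-> _].
  have := two_moves_neq (i := j) (j := i) ne_ji;
    rewrite (negPf ntji) [_ && movable 1 b i]andbC.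
  by case: (_ && _).
rewrite mul2n -addnn addnA -card_two_moves.
rewrite -sum_pairs -big_split; apply: eq_bigr => i _ /=.
rewrite big_split [X in (_ = _ + X)%N]big_mkcond; congr (_ + _)%N.
by apply: eq_bigr => j _; case: ifP.
Qed.

End Moves.

(** * Norms and indicators of restrictions *)

Section RestrictedSums.

Variables (m l : nat) (b : {ffun 'I_l -> nat}).
Hypothesis b_dec : strict_dec b.

Let r1 := #|[set i | movable 1 b i]|.
Let r2 := #|[set i | movable 2 b i]|.

Lemma sum_lower_movable k i n : movable k b i ->
  (\sum_i b i = n + k + 'C(l, 2))%N -> (\sum_j lower b i k j = n + 'C(l, 2))%N.
Proof.
move=> /movableP[le_k _] sum_b; apply/eqP;
  rewrite -(eqn_add2r k) sum_lower // sum_b.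
by rewrite addnAC.
Qed.

Lemma sum_up_sqr : (\sum_i b i = m.+1 + 'C(l, 2))%N ->
  \sum_(a : 'S_m) det_char m.+1 b (up a) ^+ 2 = m`!%:R * r1%:R.
Proof.
move=> sum_b;
  have low_sum i : movable 1 b i -> (\sum_j lower b i 1 j = m + 'C(l, 2))%N.
  by move=> mi; apply: sum_lower_movable; rewrite // addn1.
transitivity (\sum_(i | movable 1 b i) \sum_(j | movable 1 b j)
    \sum_(a : 'S_m) det_char m (lower b i 1) a * det_char m (lower b j 1) a).
  under eq_bigr => a _ do rewrite det_char_up_movable // expr2 mulr_suml.
  rewrite exchange_big; apply: eq_bigr => i _.
  under eq_bigr => a _ do rewrite mulr_sumr.
  by rewrite exchange_big.
rewrite (eq_bigr (fun=> m`!%:R)) => [|i mi].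
  by rewrite sumr_const mulr_natr; congr (_ *+ _); apply: eq_card => i;
    rewrite inE.
rewrite (bigD1 i) //= sum_det_charM low_sum // eqxx match_det_dec;
  try exact: lower_dec.
rewrite eqxx !mulr1 big1 ?addr0 // => j /andP[mj ne_ji].
rewrite sum_det_charM match_det_dec; try exact: lower_dec.
case: (_ =P lower b j 1) => [/ffunP/(_ i)|_]; last by rewrite !mulr0.
rewrite !lowerE eqxx eq_sym (negPf ne_ji); have /movableP[] := mi.
by move=> b_gt0 _ eq_b; exfalso; lia.
Qed.

Lemma sum_up_indicator : (\sum_i b i = m.+1 + 'C(l, 2))%N ->
  \sum_(a : 'S_m) det_char m.+1 b (up a ^+ 2)%g = m`!%:R * r1%:R.
Proof.
move=> sum_b;
  under eq_bigr => a _ do rewrite expgS expg1 -upM det_char_up_movable //.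
rewrite exchange_big (eq_bigr (fun=> m`!%:R)) => [|i mi].
  by rewrite sumr_const mulr_natr; congr (_ *+ _); apply: eq_card => i;
    rewrite inE.
rewrite -(det_char_indicator (lower_dec b_dec mi)) //.
by apply: sum_lower_movable; rewrite // addn1.
Qed.

Hypothesis sum_b : (\sum_i b i = m.+2 + 'C(l, 2))%N.

Let b2 i j := lower (lower b i 1) j 1.

Lemma det_char_up_up a : det_char m.+2 b (up (up a))
  = \sum_(ij : 'I_l * 'I_l | two_moves b ij.1 ij.2) det_char m (b2 ij.1 ij.2) a.
Proof.
rewrite det_char_up_movable //.
by rewrite (eq_bigr _ (fun i mi => det_char_up_movable a (lower_dec b_dec mi)))
  pair_big_dep.
Qed.

Let b2_dec i j : two_moves b i j -> strict_dec (b2 i j).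
Proof. by move=> /andP[mi mj]; apply/lower_dec/mj/lower_dec. Qed.

Let sum_b2 i j : two_moves b i j -> (\sum_k b2 i j k = m + 'C(l, 2))%N.
Proof.
move=> /andP[/movableP[gi _] /movableP[gj _]]; apply/eqP.
rewrite -(eqn_add2r 1) sum_lower // -(eqn_add2r 1) sum_lower // sum_b;
  apply/eqP; lia.
Qed.

Lemma sum_up_up_sqr : \sum_(a : 'S_m) det_char m.+2 b (up (up a)) ^+ 2
  = m`!%:R * (r2 + 2 * (r1 * r1.-1))%N%:R.
Proof.
transitivity (\sum_(p : 'I_l * 'I_l | two_moves b p.1 p.2)
   \sum_(q : 'I_l * 'I_l | two_moves b q.1 q.2)
    \sum_(a : 'S_m) det_char m (b2 p.1 p.2) a * det_char m (b2 q.1 q.2) a).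
  under eq_bigr => a _ do rewrite det_char_up_up expr2 mulr_suml.
  rewrite exchange_big; apply: eq_bigr => i _.
  under eq_bigr => a _ do rewrite mulr_sumr.
  by rewrite exchange_big.
rewrite -(sum_two_moves_eq b_dec) [in RHS]pair_big /= natr_sum mulr_sumr
  big_mkcond.
apply: eq_bigr => -[i j] _ /=; rewrite [in RHS]pair_big natr_sum mulr_sumr /=.
case: ifP => tp; last by rewrite big1 // => q _; rewrite mulr0.
rewrite big_mkcond; apply: eq_bigr => -[i' j'] _ /=.
case: ifP => tq /=; last by rewrite mulr0n mulr0.
by rewrite sum_det_charM sum_b2 // eqxx mul1r match_det_dec //; apply: b2_dec.
Qed.

Lemma sum_up_up_indicator : \sum_(a : 'S_m) det_char m.+2 b (up (up a) ^+ 2)%g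
  = m`!%:R * (r2 + r1 * r1.-1)%N%:R.
Proof.
under eq_bigr => a _ do rewrite expgS expg1 -!upM det_char_up_up.
rewrite exchange_big /= (eq_bigr (fun=> m`!%:R)) => [|[i j] tij]; last first.
  by rewrite -(det_char_indicator (b2_dec tij)) // sum_b2.
rewrite -card_two_moves // [in RHS]pair_big natr_sum mulr_sumr big_mkcond.
by apply: eq_bigr => p _; case: ifP; rewrite ?mulr1 ?mulr0.
Qed.

(** Moving different beads by 2 leads to different sets of positions, so the
  terms of [det_char_up_last2] are orthonormal. *)
Lemma sum_last2_sqr : \sum_(a : 'S_m) det_char m.+2 b (up (up a) * last2 m)%g
  ^+ 2
  = m`!%:R * r2%:R.
Proof.
have low_sum i : movable 2 b i -> (\sum_j lower b i 2 j = m + 'C(l, 2))%N.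
  by move=> mi; apply: sum_lower_movable; rewrite // addn2.
have b_inj : injective b by apply: strict_dec_inj.
transitivity (\sum_(i | movable 2 b i) \sum_(j | movable 2 b j)
    \sum_(a : 'S_m) det_char m (lower b i 2) a * det_char m (lower b j 2) a).
  under eq_bigr => a _ do rewrite det_char_up_last2_movable // expr2 mulr_suml.
  rewrite exchange_big; apply: eq_bigr => i _.
  under eq_bigr => a _ do rewrite mulr_sumr.
  by rewrite exchange_big.
rewrite (eq_bigr (fun=> m`!%:R)) => [|i mi].
  by rewrite sumr_const mulr_natr; congr (_ *+ _); apply: eq_card => i;
    rewrite inE.
rewrite (bigD1 i) //= sum_det_charM low_sum // eqxx match_det_same;
  last exact: lower_inj.
rewrite !mulr1 big1 ?addr0 // => j /andP[mj ne_ji].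
rewrite sum_det_charM (_ : match_det _ _ = 0) ?mulr0 // match_detE big1 // => p
  _.
case: forallP => [/(_ j)/eqP|]; last by rewrite mulr0.
rewrite !lowerE (negPf ne_ji); have /movableP[gt1 _] := mj.
have [-> eq_b|ne_p /b_inj eq_p] := eqVneq (p j) j; first by exfalso; lia.
by rewrite -eq_p eqxx in ne_p.
Qed.

Lemma last2_sqr (a : 'S_m) : ((up (up a) * last2 m) ^+ 2 = up (up a) ^+ 2)%g.
Proof.
have tK : (last2 m * last2 m = 1)%g by rewrite /last2 tperm2.
have comm : (last2 m * up (up a) = up (up a) * last2 m)%g.
  apply: (mulgI (up (up a))^-1%g); rewrite mulKg -conjgE /last2 tpermJ.
  by rewrite up_max up_lift up_max.
by rewrite !expgS !expg0 !mulg1 -mulgA (mulgA (last2 m)) comm -mulgA tK mulg1.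
Qed.

End RestrictedSums.

(** * Determinants with three rows *)

Section ThreeRows.

Let o0 : 'I_3 := @Ordinal 3 0 isT.
Let o1 : 'I_3 := @Ordinal 3 1 isT.
Let o2 : 'I_3 := @Ordinal 3 2 isT.

Lemma forall_I3 (P : 'I_3 -> Prop) : P o0 -> P o1 -> P o2 -> forall i, P i.
Proof.
move=> P0 P1 P2 [[|[|[|//]]] lt_i].
- by rewrite (_ : Ordinal _ = o0) //; apply: val_inj.
- by rewrite (_ : Ordinal _ = o1) //; apply: val_inj.
- by rewrite (_ : Ordinal _ = o2) //; apply: val_inj.
Qed.

Let s01 := tperm o0 o1.
Let s12 := tperm o1 o2.
Let s02 := tperm o0 o2.

Let valsE : (s01 o0 = o1) * (s01 o1 = o0) * (s01 o2 = o2) *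
  (s12 o0 = o0) * (s12 o1 = o2) * (s12 o2 = o1) *
  (s02 o0 = o2) * (s02 o1 = o1) * (s02 o2 = o0).
Proof. by rewrite /s01 /s12 /s02 !permE. Qed.

Lemma sum_S3 (V : lmodType algC) (F : 'S_3 -> V) :
  \sum_s (-1) ^+ (odd_perm s) *: F s
  = F 1%g - F s01 - F s12 - F s02 + F (s01 * s12)%g + F (s12 * s01)%g.
Proof.
pose L := [:: 1%g; s01; s12; s02; (s01 * s12)%g; (s12 * s01)%g].
have uniqL : uniq L.
  by apply: (map_uniq (f := fun s : 'S_3 => (s o0, s o1)));
    rewrite /= !permM !perm1 !valsE.
have permL : perm_eq (index_enum _) L.
  rewrite perm_sym; apply: uniq_perm => //; first exact: index_enum_uniq.
  have le_size : (size (index_enum ({perm 'I_3} : finType)) <= size L)%N.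
    by rewrite [index_enum _]unlock -enumT -cardT card_Sn.
  by have [] := uniq_min_size uniqL (fun s _ => mem_index_enum s) le_size.
rewrite (perm_big _ permL) !big_cons big_nil /=.
rewrite odd_perm1 !odd_permM !odd_tperm /= !expr0 !expr1 !scale1r !scaleN1r.
by rewrite addr0 !addrA.
Qed.

Variable m : nat.

Definition perm_char3 (s : seq nat) : 'CF([set: 'S_m.+2]) := perm_char m.+2
  (parts 3 s).

Lemma stair_sub_Some (b a : {ffun 'I_3 -> nat}) (s : 'S_3) :
  (forall i, a i + stair 3 (s i) = b i)%N -> stair_sub b s = Some a.
Proof.
move=> def_b; rewrite /stair_sub; case: forallP => [_|[] i];
  last by rewrite -def_b leq_addl.
by congr Some; apply/ffunP => i; rewrite ffunE -def_b addnK.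
Qed.

Lemma stair_sub_None (b : {ffun 'I_3 -> nat}) (s : 'S_3) i :
  (b i < stair 3 (s i))%N -> stair_sub b s = None.
Proof.
by move=> lt_b; rewrite /stair_sub; case: forallP => // /(_ i);
  rewrite leqNgt lt_b.
Qed.

Let stairs : (stair 3 o0 = 2%N) * (stair 3 o1 = 1%N) * (stair 3 o2 = 0%N).
Proof. by rewrite !ffunE. Qed.

Let partsE a b c : (parts 3 [:: a; b; c] o0 = a) * (parts 3 [:: a; b; c] o1 = b)
  * (parts 3 [:: a; b; c] o2 = c).
Proof. by rewrite !ffunE. Qed.

(** With c at most 1, the two permutations that subtract 2 from the last row
  contribute nothing. *)
Lemma jacobi_trudi3 a b c : (c <= 1)%N ->
  det_char m.+2 (beta (parts 3 [:: a; b; c]))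
  = perm_char3 [:: a; b; c]
    - (if (0 < b)%N then perm_char3 [:: a.+1; b.-1; c] else 0)
    - (if (0 < c)%N then perm_char3 [:: a; b.+1; c.-1] else 0)
    + (if (0 < b)%N && (0 < c)%N then perm_char3 [:: a.+2; b.-1; c.-1] else 0).
Proof.
move=> c_le1; rewrite /det_char sum_S3 stair_sub1 /=.
(* the last row would be lowered by 2 *)
have -> : stair_sub (beta (parts 3 [:: a; b; c])) s02 = None.
  by apply: (@stair_sub_None _ _ o2);
    rewrite betaE !partsE valsE !stairs addn0 ltnS.
have -> : stair_sub (beta (parts 3 [:: a; b; c])) (s12 * s01)%g = None.
  by apply: (@stair_sub_None _ _ o2);
    rewrite betaE permM !partsE !valsE !stairs addn0 ltnS.
have -> : stair_sub (beta (parts 3 [:: a; b; c])) s01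
    = if (0 < b)%N then Some (parts 3 [:: a.+1; b.-1; c]) else None.
  case: posnP => b_gt0.
    by apply: (@stair_sub_None _ _ o1);
      rewrite betaE !partsE !valsE !stairs b_gt0.
  apply: stair_sub_Some; apply: forall_I3;
    rewrite betaE !partsE !valsE !stairs; lia.
have -> : stair_sub (beta (parts 3 [:: a; b; c])) s12
    = if (0 < c)%N then Some (parts 3 [:: a; b.+1; c.-1]) else None.
  case: posnP => c_gt0.
    by apply: (@stair_sub_None _ _ o2);
      rewrite betaE !partsE !valsE !stairs c_gt0.
  apply: stair_sub_Some; apply: forall_I3;
    rewrite betaE !partsE !valsE !stairs; lia.
have -> : stair_sub (beta (parts 3 [:: a; b; c])) (s01 * s12)%g
    = if (0 < b)%N && (0 < c)%N then Some (parts 3 [:: a.+2; b.-1; c.-1]) else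
      None.
  have [b0|b_gt0] := posnP b.
    by apply: (@stair_sub_None _ _ o1);
      rewrite betaE permM !partsE !valsE !stairs b0.
  have [c0|c_gt0] := posnP c.
    by apply: (@stair_sub_None _ _ o2);
      rewrite betaE permM !partsE !valsE !stairs c0.
  apply: stair_sub_Some; apply: forall_I3;
    rewrite betaE permM !partsE !valsE !stairs; lia.
rewrite /perm_char3 subr0 addr0; case: (0 < b)%N; case: (0 < c)%N; rewrite //=.
Qed.

End ThreeRows.

(** * Characters of depth at most two *)

Section SmallDepth.

Variable m : nat.
Implicit Type phi : 'CF([set: 'S_m.+2]).

Let o0 : 'I_3 := @Ordinal 3 0 isT.
Let o1 : 'I_3 := @Ordinal 3 1 isT.
Let o2 : 'I_3 := @Ordinal 3 2 isT.

Let bottom k : {ffun 'I_k -> 'I_3} := [ffun=> o0].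

Let content_bottom k : content (bottom k) = parts 3 [:: k; 0; 0]%N.
Proof.
apply/ffunP; apply: forall_I3; rewrite !ffunE /=.
- by rewrite -[RHS]card_ord; apply: eq_card => x; rewrite !inE ffunE.
- by apply: eq_card0 => x; rewrite !inE ffunE.
- by apply: eq_card0 => x; rewrite !inE ffunE.
Qed.

Let bottom_neq k (c : 'I_3) : c != o0 -> forall x, bottom k x != c.
Proof. by move=> ne_c x; rewrite ffunE eq_sym. Qed.

Let cfdot_word phi (w : {ffun 'I_m.+2 -> 'I_3}) s : content w = parts 3 s ->
  '[phi, perm_char3 m s] = (\sum_(g in stab w) 1)^-1 * \sum_(g in stab w) phi g.
Proof.
move=> def_s; rewrite /perm_char3 -def_s cfdot_perm_char; congr (_^-1 * _).
by rewrite sumr_const.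
Qed.

Definition avg k (f : 'S_k -> algC) : algC := k`!%:R^-1 * \sum_a f a.

Let sum_bottom k (f : 'S_k -> algC) : \sum_(a in stab (bottom k)) f a = \sum_a
  f a.
Proof. by apply: eq_bigl => a; rewrite stab_const inE. Qed.

Let sum_one k : \sum_(a : 'S_k) 1 = k`!%:R :> algC.
Proof. by rewrite sumr_const card_Sn. Qed.

(** The averages below are over the stabiliser of a word with the given content
  in which the letters other than the first occupy the last positions. *)
Lemma cfdot_jt0 phi : '[phi, perm_char3 m [:: m.+2; 0; 0]%N] = avg phi.
Proof. by rewrite (cfdot_word phi (content_bottom _)) !sum_bottom sum_one. Qed.

Lemma cfdot_jt1 phi s : s \in [:: [:: m.+1; 1; 0]; [:: m.+1; 0; 1]]%N ->
  '[phi, perm_char3 m s] = avg (fun a : 'S_m.+1 => phi (up a)).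
Proof.
rewrite !inE => /orP[] /eqP->.
  rewrite (cfdot_word phi (w := extend o1 (bottom m.+1))).
    by rewrite !sum_stab_extend ?sum_bottom ?sum_one //; apply: bottom_neq.
  by rewrite content_extend content_bottom; apply/ffunP; apply: forall_I3;
    rewrite !ffunE.
rewrite (cfdot_word phi (w := extend o2 (bottom m.+1))).
  by rewrite !sum_stab_extend ?sum_bottom ?sum_one //; apply: bottom_neq.
by rewrite content_extend content_bottom; apply/ffunP; apply: forall_I3;
  rewrite !ffunE.
Qed.

Lemma cfdot_jt11 phi :
  '[phi, perm_char3 m [:: m; 1; 1]%N] = avg (fun a : 'S_m => phi (up (up a))).
Proof.
rewrite (cfdot_word phi (w := extend o2 (extend o1 (bottom m)))).
  have ne_o2 x : extend o1 (bottom m) x != o2.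
    by rewrite ffunE; case: unlift => [y|//]; rewrite ffunE.
  by rewrite !(sum_stab_extend _ ne_o2)
    !(sum_stab_extend _ (bottom_neq (isT : o1 != o0))) !sum_bottom sum_one.
by rewrite !content_extend content_bottom; apply/ffunP; apply: forall_I3;
  rewrite !ffunE.
Qed.

Lemma cfdot_jt2 phi : '[phi, perm_char3 m [:: m; 2; 0]%N]
  = 2^-1 * (avg (fun a : 'S_m => phi (up (up a))) + avg
    (fun a : 'S_m => phi (up (up a) * last2 m)%g)).
Proof.
rewrite (cfdot_word phi (w := extend o1 (extend o1 (bottom m)))).
  rewrite !(sum_stab_extend2 _ (bottom_neq (isT : o1 != o0))) !sum_bottom
    !big_split /= sum_one.
  have -> : m`!%:R + m`!%:R = 2 * m`!%:R :> algC by rewrite mulr_natl mulr2n.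
  by rewrite invfM -mulrA /avg -mulrDr.
by rewrite !content_extend content_bottom; apply/ffunP; apply: forall_I3;
  rewrite !ffunE.
Qed.

Lemma Sn_irr_depth0 : Sn_irr m.+2 [:: m.+2] = perm_char3 m [:: m.+2; 0; 0]%N.
Proof.
have part : is_partition m.+2 [:: m.+2] by rewrite /is_partition /= addn0 eqxx.
rewrite (Sn_irr_det (l := 3) part) //.
have -> : parts 3 [:: m.+2] = parts 3 [:: m.+2; 0; 0]%N.
  by apply/ffunP; apply: forall_I3; rewrite !ffunE.
by rewrite jacobi_trudi3 //= !subr0 addr0.
Qed.

Lemma Sn_irr_depth1 : Sn_irr m.+2 [:: m.+1; 1]%N
  = perm_char3 m [:: m.+1; 1; 0]%N - perm_char3 m [:: m.+2; 0; 0]%N.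
Proof.
have part : is_partition m.+2 [:: m.+1; 1]%N by rewrite /is_partition /= addn0
  addn1 eqxx.
rewrite (Sn_irr_det (l := 3) part) //.
have -> : parts 3 [:: m.+1; 1]%N = parts 3 [:: m.+1; 1; 0]%N.
  by apply/ffunP; apply: forall_I3; rewrite !ffunE.
by rewrite jacobi_trudi3 //= !subr0 addr0.
Qed.

Hypothesis m_ge2 : (2 <= m)%N.

Lemma Sn_irr_depth2 : Sn_irr m.+2 [:: m; 2]%N
  = perm_char3 m [:: m; 2; 0]%N - perm_char3 m [:: m.+1; 1; 0]%N.
Proof.
have part : is_partition m.+2 [:: m; 2]%N.
  by rewrite /is_partition /= !inE addn0 addn2 eqxx m_ge2 !andbT;
    case: (m) m_ge2.
rewrite (Sn_irr_det (l := 3) part) //.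
have -> : parts 3 [:: m; 2]%N = parts 3 [:: m; 2; 0]%N.
  by apply/ffunP; apply: forall_I3; rewrite !ffunE.
by rewrite jacobi_trudi3 //= !subr0 addr0.
Qed.

Lemma Sn_irr_depth11 : Sn_irr m.+2 [:: m; 1; 1]%N
  = perm_char3 m [:: m; 1; 1]%N - perm_char3 m [:: m.+1; 0; 1]%N
    - perm_char3 m [:: m; 2; 0]%N
    + perm_char3 m [:: m.+2; 0; 0]%N.
Proof.
have part : is_partition m.+2 [:: m; 1; 1]%N.
  by rewrite /is_partition /= !inE addn0 addn2 eqxx !andbT; case: (m) m_ge2.
by rewrite (Sn_irr_det (l := 3) part) // jacobi_trudi3.
Qed.

Lemma partitions_small_depth :
  perm_eq [seq mu <- partitions m.+2 | ~~ (2 < depth mu)%N]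
    [:: [:: m.+2]; [:: m.+1; 1]; [:: m; 2]; [:: m; 1; 1]]%N.
Proof.
apply: uniq_perm; first by rewrite filter_uniq ?partitions_uniq.
  by rewrite /= !inE !eqseq_cons /= !(andbF, orbF).
move=> mu; rewrite mem_filter mem_partitions -leqNgt /depth !inE.
apply/andP/idP => [[small /and3P[sorted_mu mu_n0 /eqP sum_mu]]|].
  case: mu small sorted_mu mu_n0 sum_mu => [|a [|b [|c [|d s]]]] //=;
    rewrite ?inE ?negb_or.
  - by rewrite addn0 => _ _ _ ->; rewrite eqxx.
  - rewrite addn0 => small /andP[le_ba _] /andP[a0 b0] sum_mu.
    have [b1|b2] : b = 1%N \/ b = 2%N by lia.
      have a1 : a = m.+1 by lia.
      by rewrite a1 b1 eqxx orbT.
    have a2 : a = m by lia.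
    by rewrite a2 b2 eqxx !orbT.
  - rewrite addn0 => small _ /and3P[a0 b0 c0] sum_mu.
    have [a1 b1 c1] : [/\ a = m, b = 1%N & c = 1%N] by split; lia.
    by rewrite a1 b1 c1 eqxx !orbT.
  - by move=> small _ /and5P[a0 b0 c0 d0 _] sum_mu; lia.
by case/or4P => /eqP->; split; rewrite /is_partition /= ?inE; lia.
Qed.

End SmallDepth.

(** * Coefficients of the symmetric and alternating squares *)

Section SquareAverages.

Variables (m : nat) (la : seq nat).
Hypothesis hla : is_partition m.+2 la.

Let chi := Sn_irr m.+2 la.
Let l := size la.
Let b := beta (parts l la).
Let r1 := nhooks 1 la.
Let r2 := nhooks 2 la.

Let chiE : chi = det_char m.+2 b.
Proof. exact: Sn_irr_det. Qed.

Let b_dec : strict_dec b.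
Proof. exact: beta_mono (parts_dec hla (l := l)). Qed.

Let sum_b : (\sum_i b i = m.+2 + 'C(l, 2))%N.
Proof. exact: sum_beta (sum_parts hla (leqnn _)). Qed.

Let r1E : r1 = #|[set i | movable 1 b i]|.
Proof. exact: (nhooks_movable hla). Qed.

Let r2E : r2 = #|[set i | movable 2 b i]|.
Proof. exact: (nhooks_movable hla). Qed.

Let factK k x : k`!%:R^-1 * (k`!%:R * x) = x :> algC.
Proof. by rewrite mulKf // pnatr_eq0 -lt0n fact_gt0. Qed.

(** Otherwise the branching rule at the identity would give the degree 0. *)
Lemma removable_box_exists : (0 < r1)%N.
Proof.
rewrite r1E lt0n cards_eq0; apply: contraTneq isT => no_move.
have : chi 1%g != 0 by apply: irr1_neq0.
rewrite chiE.
have <- : up 1 = 1%g :> 'S_m.+2 by apply: lift_perm1.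
rewrite det_char_up_movable // big1 ?eqxx // => i mi.
by have := in_set0 i; rewrite -no_move inE mi.
Qed.

Lemma avg_sqr : avg (fun g => chi g ^+ 2) = 1.
Proof.
rewrite /avg chiE; under eq_bigr do rewrite expr2.
by rewrite sum_det_charM factK sum_b eqxx mul1r match_det_same //;
  apply: strict_dec_inj.
Qed.

Lemma avg_indicator : avg (fun g => chi (g ^+ 2)%g) = 1.
Proof. by rewrite /avg chiE det_char_indicator // mulVf // pnatr_eq0 -lt0n
  fact_gt0. Qed.

Lemma avg_up_sqr : avg (fun a : 'S_m.+1 => chi (up a) ^+ 2) = r1%:R.
Proof. by rewrite /avg chiE sum_up_sqr // factK r1E. Qed.

Lemma avg_up_indicator : avg (fun a : 'S_m.+1 => chi (up a ^+ 2)%g) = r1%:R.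
Proof. by rewrite /avg chiE sum_up_indicator // factK r1E. Qed.

Lemma avg_up_up_sqr :
  avg (fun a : 'S_m => chi (up (up a)) ^+ 2) = (r2 + 2 * (r1 * r1.-1))%N%:R.
Proof. by rewrite /avg chiE sum_up_up_sqr // factK r1E r2E. Qed.

Lemma avg_up_up_indicator :
  avg (fun a : 'S_m => chi (up (up a) ^+ 2)%g) = (r2 + r1 * r1.-1)%N%:R.
Proof. by rewrite /avg chiE sum_up_up_indicator // factK r1E r2E. Qed.

Lemma avg_last2_sqr :
  avg (fun a : 'S_m => chi (up (up a) * last2 m)%g ^+ 2) = r2%:R.
Proof. by rewrite /avg chiE sum_last2_sqr // factK r2E. Qed.

Lemma avg_last2_indicator :
  avg (fun a : 'S_m => chi ((up (up a) * last2 m) ^+ 2)%g) =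
    (r2 + r1 * r1.-1)%N%:R.
Proof.
by rewrite -avg_up_up_indicator /avg; under eq_bigr do rewrite last2_sqr.
Qed.

End SquareAverages.

Section Average.

Variable k : nat.
Implicit Types f h : 'S_k -> algC.

Lemma avg_half_add f h :
  avg (fun a => 2^-1 * (f a + h a)) = 2^-1 * (avg f + avg h).
Proof. by rewrite /avg -mulr_sumr big_split /= mulrCA mulrDr. Qed.

Lemma avg_half_sub f h :
  avg (fun a => 2^-1 * (f a - h a)) = 2^-1 * (avg f - avg h).
Proof. by rewrite /avg -mulr_sumr sumrB mulrCA mulrBr. Qed.

Lemma eq_avg f h : f =1 h -> avg f = avg h.
Proof. by move=> eq_fh; rewrite /avg (eq_bigr h). Qed.

End Average.

Lemma cfSym2E n (chi : 'CF([set: 'S_n])) g :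
  cfSym2 chi g = 2^-1 * (chi g ^+ 2 + chi (g ^+ 2)%g).
Proof. by rewrite cfunE inE mul1r. Qed.

Lemma cfAlt2E n (chi : 'CF([set: 'S_n])) g :
  cfAlt2 chi g = 2^-1 * (chi g ^+ 2 - chi (g ^+ 2)%g).
Proof. by rewrite cfunE inE mul1r. Qed.

Lemma bin2_natr k : 'C(k, 2)%:R = 2^-1 * (k%:R * (k%:R - 1)) :> algC.
Proof.
case: k => [|k]; first by rewrite mul0r mulr0.
have := mul_bin_diag k.+1 1;
  rewrite bin1 /= => /(congr1 (fun x => x%:R : algC)).
by rewrite !natrM => def_C;
  rewrite -[k.+1%:R - 1](_ : k%:R = _) ?def_C ?mulKf ?pnatr_eq0 // -addn1 natrD
    addrK.
Qed.

Section Coefficients.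

Variables (m : nat) (la : seq nat).
Hypothesis m_ge2 : (2 <= m)%N.
Hypothesis hla : is_partition m.+2 la.

Let chi := Sn_irr m.+2 la.
Let r1 := nhooks 1 la.
Let r2 := nhooks 2 la.

Let r1R : r1.-1%:R = r1%:R - 1 :> algC.
Proof. by rewrite -[in RHS](prednK (removable_box_exists hla : 0 < r1)%N)
  -addn1 natrD addrK. Qed.

Let sym0 : avg (fun g => cfSym2 chi g) = 1.
Proof.
rewrite (eq_avg (cfSym2E chi)) avg_half_add avg_sqr // avg_indicator //.
by field.
Qed.

Let alt0 : avg (fun g => cfAlt2 chi g) = 0.
Proof.
rewrite (eq_avg (cfAlt2E chi)) avg_half_sub avg_sqr // avg_indicator //.
by field.
Qed.

Let sym1 : avg (fun a : 'S_m.+1 => cfSym2 chi (up a)) = r1%:R.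
Proof.
rewrite (eq_avg (fun a => cfSym2E chi (up a))) avg_half_add avg_up_sqr
  // avg_up_indicator //.
by rewrite -/r1; field.
Qed.

Let alt1 : avg (fun a : 'S_m.+1 => cfAlt2 chi (up a)) = 0.
Proof.
rewrite (eq_avg (fun a => cfAlt2E chi (up a))) avg_half_sub avg_up_sqr
  // avg_up_indicator //.
by rewrite -/r1; field.
Qed.

Let sym2 : avg (fun a : 'S_m => cfSym2 chi (up (up a)))
  = r2%:R + 2^-1 * 3 * (r1%:R * (r1%:R - 1)).
Proof.
rewrite (eq_avg (fun a => cfSym2E chi (up (up a)))) avg_half_add avg_up_up_sqr
  // avg_up_up_indicator //.
by rewrite -/r1 -/r2 !natrD !natrM r1R; field.
Qed.

Let alt2 : avg (fun a : 'S_m => cfAlt2 chi (up (up a))) = 2^-1 *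
  (r1%:R * (r1%:R - 1)).
Proof.
rewrite (eq_avg (fun a => cfAlt2E chi (up (up a)))) avg_half_sub avg_up_up_sqr
  // avg_up_up_indicator //.
by rewrite -/r1 -/r2 !natrD !natrM r1R; field.
Qed.

Let sym2t : avg (fun a : 'S_m => cfSym2 chi (up (up a) * last2 m)%g)
  = r2%:R + 2^-1 * (r1%:R * (r1%:R - 1)).
Proof.
rewrite (eq_avg (fun a => cfSym2E chi (up (up a) * last2 m)%g)) avg_half_add
  avg_last2_sqr // avg_last2_indicator //.
by rewrite -/r1 -/r2 !natrD !natrM r1R; field.
Qed.

Let alt2t : avg (fun a : 'S_m => cfAlt2 chi (up (up a) * last2 m)%g)
  = - (2^-1 * (r1%:R * (r1%:R - 1))).
Proof.
rewrite (eq_avg (fun a => cfAlt2E chi (up (up a) * last2 m)%g)) avg_half_sub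
  avg_last2_sqr // avg_last2_indicator //.
by rewrite -/r1 -/r2 !natrD !natrM r1R; field.
Qed.

Lemma sg_depth0 : sg m.+2 la [:: m.+2] = 1.
Proof. by rewrite /sg Sn_irr_depth0 cfdot_jt0 -/chi sym0. Qed.

Lemma ag_depth0 : ag m.+2 la [:: m.+2] = 0.
Proof. by rewrite /ag Sn_irr_depth0 cfdot_jt0 -/chi alt0. Qed.

Lemma sg_depth1 : sg m.+2 la [:: m.+1; 1]%N = r1%:R - 1.
Proof.
by rewrite /sg Sn_irr_depth1 cfdotBr cfdot_jt0 cfdot_jt1 ?inE ?eqxx // -/chi
  sym0 sym1.
Qed.

Lemma ag_depth1 : ag m.+2 la [:: m.+1; 1]%N = 0.
Proof.
by rewrite /ag Sn_irr_depth1 cfdotBr cfdot_jt0 cfdot_jt1 ?inE ?eqxx // -/chi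
  alt0 alt1 subr0.
Qed.

Lemma sg_depth2 : sg m.+2 la [:: m; 2]%N = r2%:R + r1%:R * (r1%:R - 2).
Proof.
rewrite /sg Sn_irr_depth2 // cfdotBr cfdot_jt2 cfdot_jt1 ?inE ?eqxx // -/chi
  sym1 sym2 sym2t.
by field.
Qed.

Lemma ag_depth2 : ag m.+2 la [:: m; 2]%N = 0.
Proof.
rewrite /ag Sn_irr_depth2 // cfdotBr cfdot_jt2 cfdot_jt1 ?inE ?eqxx // -/chi
  alt1 alt2 alt2t.
by field.
Qed.

Lemma sg_depth11 : sg m.+2 la [:: m; 1; 1]%N = 'C(r1 - 1, 2)%:R.
Proof.
rewrite /sg Sn_irr_depth11 // cfdotDr !cfdotBr cfdot_jt0 cfdot_jt11 cfdot_jt2.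
rewrite cfdot_jt1 ?inE ?eqxx ?orbT // -/chi sym0 sym1 sym2 sym2t.
by rewrite bin2_natr subn1 r1R; field.
Qed.

Lemma ag_depth11 : ag m.+2 la [:: m; 1; 1]%N = 'C(r1, 2)%:R.
Proof.
rewrite /ag Sn_irr_depth11 // cfdotDr !cfdotBr cfdot_jt0 cfdot_jt11 cfdot_jt2.
rewrite cfdot_jt1 ?inE ?eqxx ?orbT // -/chi alt0 alt1 alt2 alt2t.
by rewrite bin2_natr; field.
Qed.

End Coefficients.

Lemma sum_partitions_by_depth m (V : nmodType) (F : seq nat -> V) :
  (2 <= m)%N ->
  \sum_(mu <- partitions m.+2) F mu
  = F [:: m.+2] + F [:: m.+1; 1]%N + F [:: m; 2]%N + F [:: m; 1; 1]%N
    + \sum_(mu <- partitions m.+2 | (2 < depth mu)%N) F mu.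
Proof.
move=> m_ge2; rewrite (bigID (fun mu => 2 < depth mu)%N) /= addrC;
  congr (_ + _).
rewrite -big_filter (perm_big _ (partitions_small_depth m_ge2)).
by rewrite !big_cons big_nil /= addr0 !addrA.
Qed.

Theorem theorem5p2 (n : nat) (la : seq nat)
    (hn : (4 <= n)%N) (hla : is_partition n la) :
  let r1 : nat := nhooks 1 la in
  let r2 : nat := nhooks 2 la in
  let a1 : int := r1%:Z - 1 in
  let a2 : int := r2%:Z + r1%:Z * (r1%:Z - 2) in
  [/\ cfSym2 (Sn_irr n la) = \sum_(mu <- partitions n) sg n la mu *: Sn_irr n mu
    & cfAlt2 (Sn_irr n la) = \sum_(mu <- partitions n) ag n la mu *: Sn_irr n mu]
  /\
  [/\ sg n la [:: n - 1; 1]%N = a1%:~R,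
      ag n la [:: n - 1; 1]%N = 0,
      sg n la [:: n - 2; 2]%N = a2%:~R
    & ag n la [:: n - 2; 2]%N = 0]
  /\
  [/\ sg n la [:: n - 2; 1; 1]%N = 'C(r1 - 1, 2)%:R
    & ag n la [:: n - 2; 1; 1]%N = 'C(r1, 2)%:R]
  /\
  [/\ cfSym2 (Sn_irr n la) =
        Sn_irr n [:: n] + a1%:~R *: Sn_irr n [:: n - 1; 1]%N
        + a2%:~R *: Sn_irr n [:: n - 2; 2]%N
        + 'C(r1 - 1, 2)%:R *: Sn_irr n [:: n - 2; 1; 1]%N
        + \sum_(mu <- partitions n | (2 < depth mu)%N) sg n la mu *: Sn_irr n mu
    & cfAlt2 (Sn_irr n la) =
        'C(r1, 2)%:R *: Sn_irr n [:: n - 2; 1; 1]%N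
        + \sum_(mu <- partitions n | (2 < depth mu)%N) ag n la mu *: Sn_irr n mu].
Proof.
case: n hn hla => [|[|m]] // m_ge2 hla' r1 r2 a1 a2; rewrite !subSS !subn0.
have a1E : a1%:~R = r1%:R - 1 :> algC by rewrite rmorphB /= -pmulrn.
have a2E : a2%:~R = r2%:R + r1%:R * (r1%:R - 2) :> algC.
  by rewrite rmorphD rmorphM rmorphB /= -!pmulrn.
have sym_sum : cfSym2 (Sn_irr m.+2 la)
   = \sum_(mu <- partitions m.+2) sg m.+2 la mu *: Sn_irr m.+2 mu.
  exact: cfun_sum_partitions.
have alt_sum : cfAlt2 (Sn_irr m.+2 la)
   = \sum_(mu <- partitions m.+2) ag m.+2 la mu *: Sn_irr m.+2 mu.
  exact: cfun_sum_partitions.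
split; first by split.
split; first by rewrite a1E a2E sg_depth1 // ag_depth1 // sg_depth2
  // ag_depth2.
split; first by rewrite sg_depth11 // ag_depth11.
rewrite sym_sum alt_sum !sum_partitions_by_depth //.
rewrite sg_depth0 // ag_depth0 // sg_depth1 // ag_depth1 // sg_depth2
  // ag_depth2 //.
rewrite sg_depth11 // ag_depth11 // a1E a2E scale1r !scale0r !add0r.
by split.
Qed.
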